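(* Let $m,n\in\mathbf{N}_0$, let $\mu$ be a partition of $m$ and $\nu$ a partition of $n$. The maximal partitions $\lambda$ in the dominance order such that $s_\lambda$ is a constituent of $s_\nu\circ s_\mu$ (i.e. $\langle s_\nu\circ s_\mu,s_\lambda\rangle\ge1$) are precisely the maximal weights, in the dominance order, of the plethystic semistandard tableaux of shape $\mu^\nu$. Moreover if $\lambda$ is such a maximal partition then $\langle s_\nu\circ s_\mu,s_\lambda\rangle$ is the number of plethystic semistandard tableaux of shape $\mu^\nu$ and weight $\lambda$.
   Context: $s_\lambda$ is the Schur function labelled by $\lambda$; $\circ$ is plethysm of symmetric functions ($f\circ s_\mu$ is obtained from $f(x_1,x_2,\ldots)$ by substituting for its variables the monomials $x^t$, for $t$ ranging over all semistandard $\mu$-tableaux with entries in $\mathbf{N}=\{1,2,\ldots\}$); $\langle\cdot,\cdot\rangle$ is the Hall inner product, for which Schur functions are orthonormal. A tableau with entries in a totally ordered set is semistandard if its rows are weakly increasing from left to right and its columns strictly increasing from top to bottom. Let $\mathrm{SSYT}_{\mathbf{N}}(\mu)$ be the set of semistandard $\mu$-tableaux with entries from $\mathbf{N}$, totally ordered by: $t<u$ if and only if, in the rightmost column in which $t$ and $u$ differ, the greatest entry not appearing in both columns lies in $u$. A plethystic semistandard tableau of shape $\mu^\nu$ is a semistandard $\nu$-tableau whose entries are elements of $\mathrm{SSYT}_{\mathbf{N}}(\mu)$ (with this order). Its weight $\mathrm{wt}(T)$ is the composition $(\beta_1,\ldots,\beta_M)$ where $M$ is the greatest integer appearing in its $\mu$-tableau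 entries and $\beta_b$ is the total number of occurrences of $b$ in its $\mu$-tableau entries. Dominance order on compositions (in particular partitions) of the same integer: $\beta\unrhd\gamma$ if $\beta_1+\cdots+\beta_i\ge\gamma_1+\cdots+\gamma_i$ for all $i\in\mathbf{N}$, parts beyond the last being $0$. *)

(* Defs.v *)
From HB Require Import structures.
From mathcomp Require Import all_boot all_order all_algebra finmap mpoly.
From mathcomp Require Import boolp classical_sets functions cardinality.

Set Implicit Arguments.
Unset Strict Implicit.
Unset Printing Implicit Defensive.

Import GRing.Theory Num.Theory.
Local Open Scope ring_scope.

(* Partitions and compositions are sequences of naturals; a partition has     *)
(* only positive parts, so that it is determined by its Young diagram.        *)
Definition is_partition (la : seq nat) : bool := sorted geq la && (0 \notin la)%N.

Definition partition_of (n : nat) (la : seq nat) : bool :=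
  is_partition la && (sumn la == n).

(* [dominates be ga] is be |> ga. As [take i] is the identity beyond the      *)
(* length, missing parts count as 0.                                          *)
Definition dominates (be ga : seq nat) : Prop :=
  sumn be = sumn ga /\ forall i, (sumn (take i ga) <= sumn (take i be))%N.

Definition dom_maximal (P : seq nat -> Prop) (la : seq nat) : Prop :=
  P la /\ forall ka, P ka -> dominates ka la -> ka = la.

(* A tableau is the sequence of its rows; [shape t] is the sequence of row    *)
(* lengths. Columns are numbered from 0.                                      *)
Section Tableaux.
Variable T : eqType.
Implicit Types (lt : rel T) (t : seq (seq T)).

Definition column t (j : nat) : seq T := pmap (fun r => onth r j) t.

Definition semistandard lt t : bool :=
  all (sorted (fun x y => (x == y) || lt x y)) t &&
  all (fun j => sorted lt (column t j)) (iota 0 (size (head [::] t))).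

(* All fillings of the diagram of la with entries drawn from the list A.      *)
Fixpoint words (k : nat) (A : seq T) : seq (seq T) :=
  if k is k'.+1 then [seq x :: w | x <- A, w <- words k' A] else [:: [::]].

Fixpoint fillings (la : seq nat) (A : seq T) : seq (seq (seq T)) :=
  if la is k :: la' then [seq r :: t | r <- words k A, t <- fillings la' A]
  else [:: [::]].

End Tableaux.

Definition SSYT (mu : seq nat) : pred (seq (seq nat)) :=
  [pred t | [&& shape t == mu, semistandard ltn t & all (leq 1) (flatten t)]].

(* The members of [SSYT mu] with all entries in {1, ..., N}. *)
Definition SSYT_upto (mu : seq nat) (N : nat) : seq (seq (seq nat)) :=
  [seq t <- fillings mu (iota 1 N) | semistandard ltn t].

(* The greatest entry not in both columns exists and lies in d. *)
Definition column_lt (c d : seq nat) : bool :=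
  has (fun x => (x \notin c) &&
         all (fun y => ((y \in c) && (y \in d)) || (y <= x)%N) (c ++ d)) d.

(* The total order on [SSYT mu], meaningful for tableaux of the same shape.   *)
Definition tableau_lt (t u : seq (seq nat)) : bool :=
  let w := size (head [::] t) in
  has (fun j => column_lt (column t j) (column u j) &&
         all (fun k => (j < k)%N ==> (column t k == column u k)) (iota 0 w))
      (iota 0 w).

Definition plethystic_SSYT (mu nu : seq nat) :
    pred (seq (seq (seq (seq nat)))) :=
  [pred T | [&& shape T == nu, semistandard tableau_lt T &
                all (SSYT mu) (flatten T)]].

Definition weight (T : seq (seq (seq (seq nat)))) : seq nat :=
  let e := flatten (flatten (flatten T)) in
  [seq count_mem b e | b <- iota 1 (\max_(b <- e) b)].

(* A symmetric function f is represented by the family of its truncations     *)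
(* f(x_1, ..., x_N); the variable x_b is 'X_(b - 1).                          *)
Definition truncations : Type := forall N : nat, {mpoly int[N]}.

Definition tableau_monomial (N : nat) (t : seq (seq nat)) : {mpoly int[N]} :=
  'X_[[multinom count_mem (val i).+1 (flatten t) | i < N]].

Definition schur (la : seq nat) : truncations :=
  fun N => \sum_(t <- SSYT_upto la N) tableau_monomial N t.

(* f o s_mu. The order in which the monomials x^t are substituted for the     *)
(* variables of f is immaterial because f is symmetric.                       *)
Definition plethysm (f : truncations) (mu : seq nat) : truncations :=
  fun N => let L := [seq tableau_monomial N t | t <- SSYT_upto mu N] in
           f (size L) \mPo in_tuple L.

Definition schur_expansion (f : truncations)
    (c : {fsfun seq nat -> int with 0}) : Prop :=
  (forall la, la \in finsupp c -> is_partition la) /\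
  (forall N, f N = \sum_(la <- finsupp c) c la *: schur la N).

(* The coefficients of f in the basis of Schur functions; they are unique by  *)
(* [schur_expansion_inj] below. The default is used only if f is not a        *)
(* symmetric function.                                                        *)
Definition schur_coef (f : truncations) : {fsfun seq nat -> int with 0} :=
  xget [fsfun] [set c | schur_expansion f c]%classic.

Definition hall (f g : truncations) : int :=
  \sum_(la <- finsupp (schur_coef f)) schur_coef f la * schur_coef g la.

Definition is_constituent (mu nu la : seq nat) : Prop :=
  is_partition la /\ 1 <= hall (plethysm (schur nu) mu) (schur la).

Definition is_weight (mu nu la : seq nat) : Prop :=
  exists2 T, T \in plethystic_SSYT mu nu & weight T = la.

Section Enumeration.
Variable T : eqType.
Implicit Types (A : seq T) (la : seq nat).

Lemma mem_words k A w : (w \in words k A) = (size w == k) && all (mem A) w.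
Proof.
elim: k w => [|k IH] [|x w] //=.
  by apply/negbTE/negP => /allpairsP[[y v] []].
rewrite eqSS andbCA -IH; apply/allpairsP/andP => [[[y v] /= []]|[xA wA]].
  by move=> yA vA [-> ->].
by exists (x, w).
Qed.

Lemma mem_fillings la A t :
  (t \in fillings la A) = (shape t == la) && all (mem A) (flatten t).
Proof.
elim: la t => [|k la IH] [|r t] //=.
  by apply/negbTE/negP => /allpairsP[[y v] []].
rewrite eqseq_cons all_cat andbACA -IH -mem_words.
apply/allpairsP/andP => [[[y v] /= []]|[xA wA]]; last by exists (r, t).
by move=> yA vA [-> ->].
Qed.

Lemma fillings_uniq la A : uniq A -> uniq (fillings la A).
Proof.
have inj2 (U : eqType) (s1 : seq U) (s2 : seq (seq U)) :
    {in [seq (x, y) | x <- s1, y <- s2] &,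
       injective (uncurry (@cons U))}.
  by move=> [x y] [x' y'] _ _ [-> ->].
move=> uA; have uw k : uniq (words k A).
  by elim: k => //= k IH; apply: allpairs_uniq.
by elim: la => //= k la IH; apply: allpairs_uniq.
Qed.

End Enumeration.

Lemma mem_SSYT_upto mu N t :
  (t \in SSYT_upto mu N) = (t \in SSYT mu) && all (geq N) (flatten t).
Proof.
rewrite mem_filter mem_fillings inE andbCA -!andbA; do 3!congr (_ && _).
rewrite -all_predI; apply: eq_all => b /=.
by rewrite mem_iota add1n ltnS.
Qed.

Lemma SSYT_upto_uniq mu N : uniq (SSYT_upto mu N).
Proof. by rewrite filter_uniq // fillings_uniq // iota_uniq. Qed.

Lemma SSYT_behead (r : seq nat) t : sorted geq (shape (r :: t)) ->
  semistandard ltn (r :: t) ->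
  semistandard ltn t /\ forall k, all (leq k) r -> all (leq k.+1) (flatten t).
Proof.
move=> /= sh /andP[/= /andP[_ rows] cols].
have short q : q \in t -> (size q <= size r)%N.
  move=> qt; have gt: transitive geq by move=> a b c /= ? /leq_trans->.
  by have /allP := order_path_min gt sh; apply; apply: map_f.
have colE j x : onth r j = Some x -> path ltn x (column t j).
  move=> rj; have jr : (j < size r)%N by rewrite -onthTE rj.
  by move/allP: cols => /(_ j); rewrite mem_iota /= jr rj => /(_ isT).
have getr j : (j < size r)%N -> exists x, onth r j = Some x.
  by rewrite -onthTE; case: onth => // x _; exists x.
split.
  rewrite /semistandard rows /=; apply/allP => j; rewrite mem_iota /= => jt.
  have /getr[x /colE /path_sorted //] : (j < size r)%N.
  case: (t) short jt => //= q t' /(_ q); rewrite mem_head => /(_ isT) qr jq.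
  exact: leq_trans jq qr.
move=> k /allP rk; apply/allP => b /flattenP[q qt bq].
have jq : (index b q < size q)%N by rewrite index_mem.
have [x rx] := getr _ (leq_trans jq (short q qt)).
have /(order_path_min ltn_trans)/allP lt := colE _ _ rx.
have/lt : b \in column t (index b q).
  rewrite mem_pmap; apply/mapP; exists q => //.
  by rewrite onthE (nth_map 0%N) // nth_index.
by apply: leq_ltn_trans; apply: rk; rewrite -(onth_nth 0%N _ _ _ rx) mem_nth // -onthTE rx.
Qed.

Lemma SSYT_count_le t k i : sorted geq (shape t) -> semistandard ltn t ->
  all (leq k.+1) (flatten t) ->
  (count (geq (k + i)) (flatten t) <= sumn (take i (shape t)))%N.
Proof.
elim: t k i => [|r t IH] k [|i] // sh ss.
  move=> /allP lk; rewrite take0 addn0 leqn0 -leqn0 leqNgt -has_count.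
  by apply/hasPn => b /lk /=; rewrite -ltnNge.
have [st /(_ k.+1) H] := SSYT_behead sh ss.
rewrite /= all_cat => /andP[/H lt _]; rewrite count_cat addnS -addSn leq_add //.
  by rewrite count_size.
by apply: IH => //; apply: path_sorted sh.
Qed.

Fixpoint superstandard k (la : seq nat) :=
  if la is l :: la' then nseq l k.+1 :: superstandard k.+1 la' else [::].

Lemma SSYT_count_eq t k : sorted geq (shape t) -> semistandard ltn t ->
  all (leq k.+1) (flatten t) ->
  (forall i, count (geq (k + i)%N) (flatten t) = sumn (take i (shape t))) ->
  t = superstandard k (shape t).
Proof.
elim: t k => [|r t IH] k // sh ss.
have [st /(_ k.+1) H] := SSYT_behead sh ss.
rewrite /= all_cat => /andP[rk lt] eqc; move/H: (rk) => lk.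
have cr : count (geq k.+1) r = size r.
  have := eqc 1%N; rewrite addn1 /= take0 addn0 count_cat.
  rewrite (_ : count _ (flatten t) = 0)%N ?addn0 //.
  apply/eqP; rewrite -leqn0 leqNgt -has_count.
  by apply/hasPn => b /(allP lk) /=; rewrite -ltnNge.
have rE : r = nseq (size r) k.+1.
  apply/all_pred1P/allP => b br /=; rewrite eqn_leq (allP rk _ br) andbT.
  by move/eqP: cr; rewrite -all_count => /allP/(_ _ br).
congr (_ :: _) => //; apply: IH => //; first exact: path_sorted sh.
move=> i; have := eqc i.+1; rewrite /= count_cat addnS -addSn.
rewrite (_ : count _ r = size r); first by move/addnI.
apply/eqP; rewrite -all_count; apply/allP => b; rewrite rE => /nseqP[-> _] /=.
by rewrite leq_addr.
Qed.

Lemma shape_superstandard k la : shape (superstandard k la) = la.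
Proof. by elim: la k => //= l la IH k; rewrite size_nseq IH. Qed.

Lemma superstandard_mem k la b : b \in flatten (superstandard k la) ->
  (k < b <= k + size la)%N.
Proof.
elim: la k => //= l la IH k; rewrite mem_cat => /orP[/nseqP[-> _]|/IH].
  by rewrite addnS ltnS leqnn leq_addr.
by rewrite addnS -addSn => /andP[/ltnW-> ->].
Qed.

Lemma superstandard_count k la i :
  count_mem (k + i).+1%N (flatten (superstandard k la)) = nth 0%N la i.
Proof.
elim: la k i => [|l la IH] k [|i] //=; rewrite count_cat count_nseq /=.
  rewrite addn0 eqxx mul1n; apply/eqP; rewrite -[X in _ == X]addn0 eqn_add2l.
  rewrite -leqn0 leqNgt -has_count; apply/hasPn => b /superstandard_mem.
  by case/andP => + _; rewrite /= neq_ltn orbC => ->.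
by rewrite addnS -addSn IH eqn_leq ltnS addSn ltnS -addSn ltnNge leq_addr andbF.
Qed.

Lemma superstandard_semistandard k la : semistandard ltn (superstandard k la).
Proof.
apply/andP; split.
  elim: la k => //= l la IH k; rewrite IH andbT.
  by case: l => // l /=; elim: l => //= l ->; rewrite eqxx.
apply/allP => j _; apply: (@path_sorted _ _ k).
elim: la k => //= l la IH k; rewrite /column /=.
rewrite -/(column _ j); case E: onth => [x|] /=; last first.
  by apply: (path_le ltn_trans (ltnSn k)) (IH _).
have : x \in nseq l k.+1 by rewrite -(onth_nth 0%N _ _ _ E) mem_nth // -onthTE E.
by case/nseqP => -> _; rewrite ltnSn IH.
Qed.

Lemma count_content (s la : seq nat) : all (leq 1) s ->
  (forall b, count_mem b.+1 s = nth 0%N la b) ->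
  forall i, count (geq i) s = sumn (take i la).
Proof.
move=> s0 sla; elim=> [|i IH].
  rewrite take0; apply/eqP; rewrite -leqn0 leqNgt -has_count.
  by apply/hasPn => b /(allP s0) /=; rewrite -ltnNge.
have -> : sumn (take i.+1 la) = (sumn (take i la) + nth 0%N la i)%N.
  have [il|li] := ltnP i (size la).
    by rewrite (take_nth 0%N) // sumn_rcons.
  by rewrite !take_oversize ?nth_default ?addn0 // leqW.
rewrite -IH -sla -count_predUI.
rewrite (_ : count (predI _ _) s = 0%N); last first.
  apply/eqP; rewrite -leqn0 leqNgt -has_count; apply/hasPn => b _ /=.
  by case: eqP => [->|]; rewrite ?andbF // ltnn.
by rewrite addn0; apply: eq_count => b /=; rewrite leq_eqVlt ltnS orbC.
Qed.

Definition monomial_of (la : seq nat) : 'X_{1.. size la} :=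
  [multinom nth 0%N la i | i < size la].

Lemma mcoeff_schur ka la :
  (schur ka (size la))@_(monomial_of la) =
  \sum_(t <- SSYT_upto ka (size la))
    (([multinom count_mem (val i).+1 (flatten t) | i < size la] : 'X_{1.. _})
       == monomial_of la)%:R.
Proof. by rewrite raddf_sum; apply: eq_bigr => t _; rewrite /= mcoeffX. Qed.

Lemma SSYT_content ka la t : t \in SSYT_upto ka (size la) ->
  [multinom count_mem (val i).+1 (flatten t) | i < size la] = monomial_of la ->
  forall i, count (geq i) (flatten t) = sumn (take i la).
Proof.
rewrite mem_SSYT_upto => /andP[/and3P[_ _ t1] tN] E.
apply: count_content => // b; have [bl|lb] := ltnP b (size la).
  by move/mnmP: E => /(_ (Ordinal bl)); rewrite !mnmE.
rewrite nth_default //; apply/eqP; rewrite -leqn0 leqNgt -has_count.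
apply/hasPn => c /(allP tN) /= cN; rewrite neq_ltn ltnS.
by rewrite (leq_trans cN lb).
Qed.

Lemma schur_dominates ka la : is_partition ka ->
  (schur ka (size la))@_(monomial_of la) != 0 -> dominates ka la.
Proof.
move=> /andP[kas _]; rewrite mcoeff_schur => nz.
have [t tS /eqP tm] : exists2 t, t \in SSYT_upto ka (size la) &
    ([multinom count_mem (val i).+1 (flatten t) | i < size la] : 'X_{1.. _})
      == monomial_of la.
  apply/hasP; apply: contraNT nz => /hasPn H.
  by rewrite big_seq big1 // => t /H /negbTE ->.
have cE := SSYT_content tS tm.
move: tS; rewrite mem_SSYT_upto => /andP[/and3P[/eqP tka ss t1] tN].
split; last first.
  by move=> i; rewrite -cE -tka -[i]add0n SSYT_count_le // tka.
have := cE (size la); rewrite take_size => <-; rewrite -tka -size_flatten.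
by apply/esym/eqP; rewrite -all_count.
Qed.

Lemma schur_diag la : is_partition la ->
  (schur la (size la))@_(monomial_of la) = 1.
Proof.
move=> /andP[las _]; rewrite mcoeff_schur.
have sS : superstandard 0 la \in SSYT_upto la (size la).
  rewrite mem_SSYT_upto !inE shape_superstandard eqxx superstandard_semistandard.
  by apply/andP; split; apply/allP => b /superstandard_mem /andP[].
rewrite (bigD1_seq _ sS (SSYT_upto_uniq _ _)) /=.
rewrite big_seq_cond big1 ?addr0 => [|t /andP[tS]]; last first.
  move=> ne; case: eqP => // /(SSYT_content tS) cE; move: ne.
  move: tS; rewrite mem_SSYT_upto => /andP[/and3P[/eqP tla ss t1] _].
  by case/eqP; rewrite -tla; apply: SSYT_count_eq; rewrite ?tla.
case: eqP => // -[]; apply/mnmP => i.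
by rewrite !mnmE -[(val i).+1]/(0 + i).+1%N superstandard_count.
Qed.

Lemma partition_eq ka la : is_partition ka -> is_partition la ->
  (forall i, (i <= (size ka + size la).+1)%N ->
     sumn (take i ka) = sumn (take i la)) -> ka = la.
Proof.
move=> /andP[_ ka0] /andP[_ la0] E.
have S (s : seq nat) i : sumn (take i.+1 s) = (sumn (take i s) + nth 0%N s i)%N.
  have [il|li] := ltnP i (size s).
    by rewrite (take_nth 0%N) // sumn_rcons.
  by rewrite !take_oversize ?nth_default ?addn0 // leqW.
have nE i : (i <= size ka + size la)%N -> nth 0%N ka i = nth 0%N la i.
  by move=> il; apply: (@addnI (sumn (take i la))); rewrite -S -!E ?S // leqW.
have nz (s : seq nat) i : (0 \notin s)%N -> (nth 0%N s i == 0%N) = (size s <= i)%N.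
  move=> s0; have [//|il] := leqP (size s) i; first by move=> ?; rewrite nth_default.
  by apply: contraNF s0 => /eqP <-; rewrite mem_nth.
have sz : size ka = size la.
  apply/eqP; rewrite eqn_leq -(nz ka) // nE ?leq_addl // nz // leqnn.
  by rewrite -(nz la) // -nE ?leq_addr // nz // leqnn.
by apply: (eq_from_nth sz) => i /ltnW il; apply: nE; apply: leq_trans il (leq_addr _ _).
Qed.

Lemma seq_argmax (U : eqType) (s : seq U) (F : U -> nat) x0 : x0 \in s ->
  exists2 x, x \in s & forall y, y \in s -> (F y <= F x)%N.
Proof.
elim: s x0 => // a [|b s] IH x0 _.
  by exists a; rewrite ?mem_head // => y; rewrite inE => /eqP->.
have [x xs xmax] := IH b (mem_head _ _).
have [ax|/ltnW xa] := leqP (F a) (F x).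
  by exists x; [rewrite inE xs orbT | move=> y; rewrite inE => /predU1P[->//|/xmax]].
exists a; rewrite ?mem_head // => y; rewrite inE => /predU1P[->//|/xmax yx].
exact: leq_trans yx xa.
Qed.

Lemma schur_expansion_inj f c d :
  schur_expansion f c -> schur_expansion f d -> c = d.
Proof.
move=> [cp cE] [dp dE]; apply/fsfunP => la0; apply/eqP/negPn/negP => ne0.
pose S := (finsupp c `|` finsupp d)%fset.
have SE N : \sum_(la <- S) (c la - d la) *: schur la N = 0.
  rewrite (eq_bigr (fun la => c la *: schur la N - d la *: schur la N));
    last by move=> la _; rewrite scalerBl.
  rewrite sumrB; apply/eqP; rewrite subr_eq0; apply/eqP.
  rewrite -(big_fset_incl _ (fsubsetUl _ (finsupp d))); last first.
    by move=> la _ /fsfun_dflt ->; rewrite scale0r.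
  rewrite -(big_fset_incl _ (fsubsetUr (finsupp c) _)); last first.
    by move=> la _ /fsfun_dflt ->; rewrite scale0r.
  by rewrite -cE -dE.
have neS la : c la != d la -> la \in S.
  by apply: contraNT; rewrite in_fsetU negb_or => /andP[/fsfun_dflt-> /fsfun_dflt->].
have pS la : la \in S -> is_partition la.
  by rewrite in_fsetU => /orP[/cp|/dp].
pose L := (\max_(la <- S) size la)%N.
have sL la : la \in S -> (size la <= L)%N by move=> laS; apply: leq_bigmax_seq.
pose F la := (\sum_(i < (L + L).+2) sumn (take i la))%N.
have [|la] := @seq_argmax _ [seq la <- S | c la != d la] F la0.
  by rewrite mem_filter ne0 neS.
rewrite mem_filter => /andP[ne laS] lamax.
have := congr1 (mcoeff (monomial_of la)) (SE (size la)).
rewrite raddf_sum mcoeff0 (bigD1_seq la) ?fset_uniq //= mcoeffZ.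
rewrite schur_diag ?pS // mulr1 big_seq_cond big1 ?addr0.
  by move/eqP; rewrite subr_eq0 (negbTE ne).
move=> ka /andP[kaS kala]; rewrite mcoeffZ; apply/eqP; rewrite mulf_eq0 subr_eq0.
have [//|ckd /=] := eqVneq (c ka) (d ka); apply: contraNT kala.
move=> /(schur_dominates (pS _ kaS)) [_ dom].
have Fk : (F ka <= F la)%N by apply: lamax; rewrite mem_filter ckd.
have lif : (F la <= F ka ?= iff [forall i : 'I_(L + L).+2,
    true ==> (sumn (take i la) == sumn (take i ka))])%N.
  by apply: leqif_sum => i _; apply/leqifP; have := dom i; rewrite leq_eqVlt; case: eqP.
have /forallP H : [forall i : 'I_(L + L).+2,
    true ==> (sumn (take i la) == sumn (take i ka))].
  by rewrite -(geq_leqif lif).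
apply/eqP/partition_eq; rewrite ?pS // => i il.
have iL : (i < (L + L).+2)%N.
  by rewrite ltnS (leq_trans il) // ltnS leq_add ?sL.
by apply/esym/eqP; have := H (Ordinal iL).
Qed.

Lemma hall_schur ka la : is_partition ka -> is_partition la ->
  hall (schur ka) (schur la) = (ka == la)%:R.
Proof.
have coefE k : is_partition k ->
    schur_coef (schur k) = [fsfun [fsfun] with k |-> 1].
  move=> pk; set e := [fsfun _ with _ |-> _].
  have fk : finsupp e = [fset k]%fset.
    by rewrite finsupp_with oner_eq0 finsupp0 fsetU0.
  have X : schur_expansion (schur k) e.
    split=> [x|N]; rewrite fk; first by rewrite inE => /eqP->.
    by rewrite big_seq_fset1 fsfun_with scale1r.
  apply: (schur_expansion_inj _ X).
  by apply: (xgetPex _ (P := [set c | schur_expansion _ c]%classic)); exists e.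
move=> pk pl; rewrite /hall !coefE // finsupp_with oner_eq0 finsupp0 fsetU0.
by rewrite big_seq_fset1 fsfun_with mul1r fsfun_withE fsfun0E; case: eqP.
Qed.

(* Main.v *)
Require Import Defs.
From mathcomp Require Import all_boot all_order all_algebra finmap mpoly zify.
From mathcomp Require Import boolp classical_sets functions cardinality.

(** Let F be the plethysm of s_nu and s_mu, and M(al) the coefficient of x^al in F.

    Two facts about F are needed. First, M(al) is the number of plethystic
    tableaux whose entries have content al (coef_plethysm). By definition F
    substitutes the monomials x^t, for t a semistandard mu-tableau, in s_nu.
    Since s_nu is symmetric they may be substituted in increasing order of t, and
    then a semistandard nu-tableau with numerical entries becomes a plethystic
    tableau when each number b is replaced by the b-th mu-tableau. Second, F is an
    integer combination of Schur functions, F = sum of c_ka s_ka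
    (schur_expansion_exists): F is symmetric because s_mu and s_nu are, its
    truncations are compatible, and the matrix of Kostka numbers K is
    unitriangular for the dominance order. Symmetry of Schur polynomials, used in
    both facts, comes from the Bender-Knuth involutions. They are described on
    Gelfand-Tsetlin patterns, where each of them reflects the entries of one line
    of the pattern in the intervals that interlacing allows.

    Comparing coefficients, M(al) is the sum of the c_ka K(ka, al), where
    K(ka, al) vanishes unless ka dominates al, and K(al, al) = 1. Let la be maximal
    for dominance among the partitions with c_la nonzero. Then only ka = la
    contributes at al = la, so c_la = M(la) (maximal_coef). This number is nonzero
    and counts tableaux, so it is positive: la is both a constituent and a weight,
    with multiplicity the number of tableaux. Conversely a constituent has c_ka
    nonzero, and a weight al has M(al) nonzero and so is dominated by some ka with
    c_ka nonzero; both are therefore dominated by a maximal la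
    (coef_neq0_dominates, maximal_above). So the maximal constituents, the maximal
    weights and the maximal elements of the support of c are the same. *)

Set Implicit Arguments.
Unset Strict Implicit.
Unset Printing Implicit Defensive.
Local Arguments column : simpl never.

(** * Rearrangements generated by adjacent exchanges *)
Definition swap (k x : nat) : nat :=
  if x == k then k.+1 else if x == k.+1 then k else x.

Lemma swapK k : involutive (swap k).
Proof. by move=> x; rewrite /swap; repeat case: ifP => /eqP; lia. Qed.

(** Bender-Knuth involutions exchange two consecutive variables only. This
    induction turns invariance under such exchanges into invariance under all
    permutations. *)
Lemma perm_adjacent_ind (V : eqType) (R : seq V -> seq V -> Prop) :
  (forall s, R s s) ->
  (forall s1 s2 s3, R s1 s2 -> R s2 s3 -> R s1 s3) ->
  (forall s a b s', R (s ++ a :: b :: s') (s ++ b :: a :: s')) ->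
  forall s1 s2, perm_eq s1 s2 -> R s1 s2.
Proof.
move=> R0 RT Rs.
have mv x p w q : R (w ++ x :: p ++ q) (w ++ p ++ x :: q).
  elim: p w => [|y p IH] w //=.
  apply: RT (Rs _ _ _ _) _.
  by have := IH (rcons w y); rewrite !cat_rcons.
suff H s1 s2 w : perm_eq s1 s2 -> R (w ++ s1) (w ++ s2).
  by move=> s1 s2 /(H _ _ [::]).
elim: s1 s2 w => [|x s1 IH] s2 w.
  by move/perm_size/esym/size0nil=> ->.
move=> e; have xs : x \in s2 by rewrite -(perm_mem e) mem_head.
case/splitPr: xs e => p q e.
have e' : perm_eq s1 (p ++ q).
  by rewrite -(perm_cons x) (perm_trans e) // -cat1s perm_catCA.
apply: RT (mv _ _ _ _); rewrite -!cat_rcons; exact: IH.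
Qed.

(** * Semistandard tableaux as interlacing arrays *)

(** A weakly increasing row is determined by the numbers of its entries below
    each bound. Recorded for all rows and bounds, these numbers form the
    Gelfand-Tsetlin pattern of the tableau. *)
Definition count_below (k : nat) (r : seq nat) := count (gtn k) r.

Lemma count_belowS k r : count_below k.+1 r = count_below k r + count_mem k r.
Proof. by elim: r => //= x r; rewrite /count_below /= => ->; lia. Qed.

Lemma count_below_le j k r : j <= k -> count_below j r <= count_below k r.
Proof. by move=> jk; apply: sub_count => x /=; lia. Qed.

Lemma sorted_count_below_inj r q : sorted leq r -> sorted leq q ->
  (forall j, count_below j r = count_below j q) -> r = q.
Proof.
move=> sr sq e; apply: (sorted_eq leq_trans anti_leq) => //.
by apply/allP => x _ /=; apply/eqP/(@addnI (count_below x r)); rewrite -count_belowS !e count_belowS.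
Qed.

Lemma nth_ltn_count_below r j k : sorted leq r -> j < size r ->
  (nth 0 r j < k) = (j < count_below k r).
Proof.
elim: r j => // x r IH [|j] /= sr jr.
  case: ltnP => //= kx; apply/esym/negbTE; rewrite -leqNgt leqn0 add0n.
  rewrite -leqn0 leqNgt -has_count; apply/hasPn => y /=.
  by move/allP: (order_path_min leq_trans sr) => /[apply]; lia.
rewrite (IH _ (path_sorted sr)) // /count_below /=; case: (ltnP x k) => /= xk.
  by rewrite add1n ltnS.
rewrite add0n; have -> : count (gtn k) r = 0; last by [].
apply/eqP; rewrite -leqn0 leqNgt -has_count; apply/hasPn => y /=.
by move/allP: (order_path_min leq_trans sr) => /[apply]; lia.
Qed.

(** In sorted rows, position [j] holds an entry below [k] exactly when [j] is
    less than the number of such entries, so a strict inequality in each column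
    becomes an inequality of counts with the bound shifted by one. *)
Lemma columns_count_belowP r q : sorted leq r -> sorted leq q -> size q <= size r ->
  (forall j, j < size q -> nth 0 r j < nth 0 q j) <->
  (forall k, count_below k.+1 q <= count_below k r).
Proof.
move=> sr sq qr; split=> [H k|H j jq].
  rewrite leqNgt; apply/negP => lt.
  have jq : count_below k r < size q by apply: leq_trans lt (count_size _ _).
  have := nth_ltn_count_below k.+1 sq jq; rewrite lt => qk.
  have := nth_ltn_count_below k sr (leq_trans jq qr).
  by rewrite ltnn (leq_trans (H _ jq)) // -ltnS qk.
rewrite nth_ltn_count_below //; last exact: leq_trans jq qr.
by apply: leq_trans (H _); rewrite -nth_ltn_count_below.
Qed.

(** [column] skips the rows that are too short. In a diagram with decreasing row
    lengths these are the lowest rows, so no cell is displaced. *)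
Lemma column_oversize (T : eqType) (t : seq (seq T)) j : sorted geq (shape t) ->
  size (head [::] t) <= j -> column t j = [::].
Proof.
elim: t => // r t IH /= sh rj; rewrite /column /= onth_default //=.
apply: IH; first exact: path_sorted sh.
by case: t sh => //= q t /andP[qr _]; apply: leq_trans qr rj.
Qed.

Lemma semistandard_rowsE (t : seq (seq nat)) :
  all (sorted (fun x y => (x == y) || ltn x y)) t = all (sorted leq) t.
Proof. by apply: eq_all => r; apply: eq_sorted => x y; rewrite /= -leq_eqVlt. Qed.

Lemma semistandard_cons r q t : sorted geq (shape (r :: q :: t)) ->
  semistandard ltn (r :: q :: t) <->
  [/\ sorted leq r, semistandard ltn (q :: t) &
     forall j, j < size q -> nth 0 r j < nth 0 q j].
Proof.
move=> sh; have /andP[qr sh'] : (size q <= size r) && sorted geq (shape (q :: t)) := sh.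
have colE j : j < size q -> column (r :: q :: t) j =
    nth 0 r j :: nth 0 q j :: column t j.
  move=> jq; rewrite /column /= !onthE.
  by rewrite !(nth_map 0) // (leq_trans jq).
have colE' j : j < size q -> column (q :: t) j = nth 0 q j :: column t j.
  by move=> jq; rewrite /column /= !onthE !(nth_map 0).
split.
  move=> H; have [st _] := SSYT_behead sh H; case/andP: H => rows /allP cols.
  move: rows; rewrite semistandard_rowsE /= => /andP[-> _]; split=> // j jq.
  have := cols j; rewrite mem_iota /= (leq_trans jq) // => /(_ isT).
  by rewrite colE //= => /andP[].
case=> sr /andP[]; rewrite semistandard_rowsE => rows /allP cols lt.
apply/andP; rewrite semistandard_rowsE [all _ _]/= sr; split=> //.
apply/allP => j; rewrite mem_iota /= => jr.
have [jq|qj] := ltnP j (size q).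
  rewrite colE //= lt //=.
  by have := cols j; rewrite mem_iota jq colE' //= => ->.
rewrite -[_ :: _ :: t]cat1s /column pmap_cat -/(column _ _) -/(column (q :: t) j).
rewrite (@column_oversize _ (q :: t)) // cats0 /column /=.
by case: onth.
Qed.

(** The interlacing form of semistandardness. Changing the counts at a single
    bound involves only the inequalities with the two neighbouring bounds, which
    is what makes the reflection below local. *)
Lemma semistandard_count_belowP t : sorted geq (shape t) ->
  semistandard ltn t <-> all (sorted leq) t /\
   (forall i k, count_below k.+1 (nth [::] t i.+1) <= count_below k (nth [::] t i)).
Proof.
elim: t => [_|r [|q t] IH sh].
- by split=> // _; split=> // -[|i] k.
- rewrite /semistandard semistandard_rowsE; split=> [/andP[-> _]|[-> _]].
    by split=> // -[|i] k.
  by apply/allP => j _; rewrite /column /=; case: onth.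
have /andP[qr sh'] : (size q <= size r) && sorted geq (shape (q :: t)) := sh.
apply: (iff_trans (semistandard_cons sh)); rewrite [all _ _]/=.
split=> [[sr /(IH sh')[/= /andP[sq st] H] lt]|[/and3P[sr sq st] H]].
  split=> [|[|i] k]; rewrite ?sr ?sq //; last exact: H.
  by apply: (columns_count_belowP sr sq qr).1.
split=> //; last by apply: (columns_count_belowP sr sq qr).2 => k; exact: (H 0).
by apply/(IH sh'); split=> [|i]; [rewrite /= sq | exact: (H i.+1)].
Qed.

(** * Bender-Knuth involutions *)
Section BenderKnuth.
Variable k : nat.
Implicit Types t : seq (seq nat).

(** The entries other than [k] and [k.+1] are kept, and the cells that those two
    letters occupy are refilled so that [g] entries of the row are at most [k].
    Sorting spares a discussion of the order of the four pieces. *)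
Definition bk_row (r : seq nat) (g : nat) : seq nat :=
  sort leq ([seq x <- r | x < k] ++ nseq (g - count_below k r) k ++
            nseq (count_below k.+2 r - g) k.+1 ++ [seq x <- r | k.+1 < x]).

Lemma count_below_bk_row r g j : count_below k r <= g <= count_below k.+2 r ->
  count_below j (bk_row r g) = if j == k.+1 then g else count_below j r.
Proof.
move=> /andP[gl gu].
rewrite /count_below (permP (permEl (perm_sort _ _))) !count_cat !count_nseq /= !count_filter.
have ltk : count (predI (gtn j) (fun x => x < k)) r = count_below (minn j k) r.
  by apply: eq_count => x /=; lia.
have gtk : count (predI (gtn j) (fun x => k.+1 < x)) r + count_below (minn j k.+2) r = count_below j r.
  rewrite /count_below -count_predUI [X in _ + X](@eq_count _ _ pred0) => [|x /=]; last by lia.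
  by rewrite count_pred0 addn0; apply: eq_count => x /=; lia.
rewrite ltk; have [jk|/eqP jk] := j =P k.+1.
  move: gtk; rewrite jk.
  have -> : minn k.+1 k = k by lia.
  have -> : minn k.+1 k.+2 = k.+1 by lia.
  by rewrite ltnSn ltnn; lia.
have [jlt|jgt] := ltnP k j.
  have jk2 : k.+2 <= j by lia.
  move: gtk; rewrite (minn_idPr jk2) /count_below => <-.
  by rewrite jk2 !mul1n; move: gl gu; rewrite /count_below; lia.
rewrite ltnNge leqW // !mul0n (@eq_count _ _ pred0) => [|x /=]; last by lia.
by rewrite count_pred0 !addn0.
Qed.

Variable t : seq (seq nat).

Definition lt_count i := count_below k (nth [::] t i).
Definition le_count i := count_below k.+1 (nth [::] t i).
Definition leS_count i := count_below k.+2 (nth [::] t i).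

(** With all other counts fixed, interlacing confines [le_count i] to the
    interval from [lower i] to [upper i], and these intervals for different rows
    do not interact. The involution reflects each count in its interval. *)
Definition lower i := maxn (lt_count i) (leS_count i.+1).
Definition upper i :=
  if i is i'.+1 then minn (leS_count i) (lt_count i') else leS_count 0.
Definition reflect_count i := lower i + upper i - le_count i.

Definition bender_knuth : seq (seq nat) :=
  mkseq (fun i => bk_row (nth [::] t i) (reflect_count i)) (size t).

End BenderKnuth.

Section BenderKnuthTheory.
Variables (k : nat) (t : seq (seq nat)).
Hypothesis tsh : sorted geq (shape t).
Hypothesis tss : semistandard ltn t.

Let cols : forall i j, count_below j.+1 (nth [::] t i.+1) <= count_below j (nth [::] t i).
Proof. by have [] := (semistandard_count_belowP tsh).1 tss. Qed.

Lemma lower_le_upper i : lower k t i <= le_count k t i <= upper k t i.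
Proof.
have le1 j : lt_count k t j <= le_count k t j by apply: count_below_le.
have le2 j : le_count k t j <= leS_count k t j by apply: count_below_le.
have c1 j : le_count k t j.+1 <= lt_count k t j by apply: cols.
have c2 j : leS_count k t j.+1 <= le_count k t j by apply: cols.
rewrite geq_max le1 c2 /=; case: i => [|i] //=.
by rewrite leq_min le2 c1.
Qed.

Lemma reflect_count_bounds i :
  [/\ lt_count k t i <= reflect_count k t i,
      leS_count k t i.+1 <= reflect_count k t i,
      reflect_count k t i <= leS_count k t i &
      forall j, i = j.+1 -> reflect_count k t i <= lt_count k t j].
Proof.
have := lower_le_upper i; rewrite /reflect_count.
have : lt_count k t i <= lower k t i by apply: leq_maxl.
have : leS_count k t i.+1 <= lower k t i by apply: leq_maxr.
have : upper k t i <= leS_count k t i by case: (i) => // j; apply: geq_minl.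
have : forall j, i = j.+1 -> upper k t i <= lt_count k t j.
  by move=> j ->; apply: geq_minr.
by move=> H; split; try lia; move=> j /H; lia.
Qed.

Lemma count_below_bender_knuth i j : count_below j (nth [::] (bender_knuth k t) i) =
  if j == k.+1 then reflect_count k t i else count_below j (nth [::] t i).
Proof.
have [H1 _ H3 _] := reflect_count_bounds i.
have [it|ti] := ltnP i (size t).
  by rewrite nth_mkseq // count_below_bk_row // H1.
rewrite !nth_default ?size_mkseq //; case: eqP => // _.
by apply/esym/eqP; rewrite -leqn0 (leq_trans H3) // /leS_count nth_default.
Qed.

Lemma size_count_below r : exists N, forall M, N <= M -> size r = count_below M r.
Proof.
exists (\max_(x <- r) x).+1 => M rM; apply/esym/eqP; rewrite -all_count.
apply/allP => x xr /=; apply: leq_trans rM; rewrite ltnS.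
exact: leq_bigmax_seq.
Qed.

(** The length of a row is its count below any large enough bound, and only the
    bound [k.+1] is affected by the reflection. *)
Lemma shape_bender_knuth : shape (bender_knuth k t) = shape t.
Proof.
apply: (@eq_from_nth _ 0); rewrite !size_map ?size_iota // => i it.
rewrite !(nth_map [::]) ?size_mkseq //.
have [N1 E1] := size_count_below (nth [::] (bender_knuth k t) i).
have [N2 E2] := size_count_below (nth [::] t i).
rewrite (E1 (maxn k.+2 (maxn N1 N2))) ?(E2 (maxn k.+2 (maxn N1 N2))); [|lia..].
by rewrite count_below_bender_knuth; case: eqP => //; lia.
Qed.

Lemma bender_knuth_rows : all (sorted leq) (bender_knuth k t).
Proof.
apply/(all_nthP [::]) => i; rewrite size_mkseq => it.
by rewrite nth_mkseq // sort_sorted //; exact: leq_total.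
Qed.

(** The ends of the interval for row [i] are its interlacing bounds with the rows
    above and below, so a reflected count satisfies the same inequalities. *)
Lemma bender_knuth_semistandard : semistandard ltn (bender_knuth k t).
Proof.
apply/semistandard_count_belowP; first by rewrite shape_bender_knuth.
split=> [|i j]; first exact: bender_knuth_rows.
rewrite !count_below_bender_knuth eqSS.
have [_ _ _ /(_ i erefl) H] := reflect_count_bounds i.+1.
have [_ H' _ _] := reflect_count_bounds i.
case: eqP => [->|_]; first by rewrite ltn_eqF.
by case: eqP => [->|_].
Qed.

Lemma bender_knuthK : bender_knuth k (bender_knuth k t) = t.
Proof.
have [rows _] := (semistandard_count_belowP tsh).1 tss.
have ltE i : lt_count k (bender_knuth k t) i = lt_count k t i.
  by rewrite /lt_count count_below_bender_knuth ltn_eqF.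
have leSE i : leS_count k (bender_knuth k t) i = leS_count k t i.
  by rewrite /leS_count count_below_bender_knuth gtn_eqF.
apply: (@eq_from_nth _ [::]); rewrite !size_mkseq // => i it.
rewrite nth_mkseq ?size_mkseq //; apply: sorted_count_below_inj.
- by rewrite sort_sorted //; exact: leq_total.
- by move/all_nthP: rows; exact.
have reflE : reflect_count k (bender_knuth k t) i = le_count k t i.
  have leE : le_count k (bender_knuth k t) i = reflect_count k t i.
    by rewrite /le_count count_below_bender_knuth eqxx.
  rewrite {1}/reflect_count leE /reflect_count.
  have -> : lower k (bender_knuth k t) i = lower k t i by rewrite /lower ltE leSE.
  have -> : upper k (bender_knuth k t) i = upper k t i.
    by case: (i) => [|j] /=; rewrite ?ltE leSE.
  by have := lower_le_upper i; lia.
move=> j; rewrite count_below_bk_row; last first.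
  rewrite -/(lt_count _ _ _) -/(leS_count _ _ _) ltE leSE reflE.
  by rewrite !count_below_le.
by rewrite reflE count_below_bender_knuth; case: eqP => // ->.
Qed.

(** The reason why the two letters exchange their multiplicities. As
    [lower i = maxn x y] and [upper i.+1 = minn y x] for [x = lt_count i] and
    [y = leS_count i.+1], the ends of the intervals add up to the fixed counts;
    the sum telescopes down the rows. *)
Lemma sum_reflect : \sum_(i < size t) (reflect_count k t i + le_count k t i) =
  \sum_(i < size t) (lt_count k t i + leS_count k t i).
Proof.
rewrite (eq_bigr (fun i : 'I__ => lower k t i + upper k t i)); last first.
  by move=> i _; rewrite subnK // ; have := lower_le_upper i; lia.
have tele n : \sum_(i < n.+1) (lower k t i + upper k t i) +
    minn (leS_count k t n.+1) (lt_count k t n) =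
    \sum_(i < n.+1) (lt_count k t i + leS_count k t i) + leS_count k t n.+1.
  elim: n => [|n IH]; first by rewrite !big_ord1 /lower /=; lia.
  rewrite big_ord_recr [in RHS]big_ord_recr /=; move: IH.
  by move: (\sum_(i < n.+1) _) (\sum_(i < n.+1) _) => x y; rewrite /lower; lia.
case E : (size t) => [|n]; first by rewrite !big_ord0.
have z : leS_count k t n.+1 = 0 by rewrite /leS_count nth_default ?E.
by have := tele n; rewrite z min0n !addn0.
Qed.

Lemma count_mem_flatten (s : seq (seq nat)) j :
  count_mem j (flatten s) + \sum_(i < size s) count_below j (nth [::] s i) =
  \sum_(i < size s) count_below j.+1 (nth [::] s i).
Proof.
rewrite count_flatten sumnE big_map (big_nth [::]) big_mkord -big_split /=.
by apply: eq_bigr => i _; rewrite count_belowS addnC.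
Qed.

(** Multiplicities are differences of consecutive counts, summed over the rows;
    [sum_reflect] gives those of [k] and [k.+1]. *)
Lemma perm_bender_knuth :
  perm_eq (flatten (bender_knuth k t)) (map (swap k) (flatten t)).
Proof.
have sum_bk j : \sum_(i < size (bender_knuth k t))
    count_below j (nth [::] (bender_knuth k t) i) =
    if j == k.+1 then \sum_(i < size t) reflect_count k t i
    else \sum_(i < size t) count_below j (nth [::] t i).
  rewrite size_mkseq; case: eqP => [->|/eqP jk]; apply: eq_bigr => i _;
  by rewrite count_below_bender_knuth ?eqxx ?(negbTE jk).
apply/allP => j _ /=; rewrite count_map.
rewrite [X in _ == X](@eq_count _ _ (pred1 (swap k j))); last first.
  move=> x /=; by rewrite (can2_eq (@swapK k) (@swapK k)).
have := count_mem_flatten (bender_knuth k t) j; rewrite !sum_bk eqSS.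
have := count_mem_flatten t (swap k j); have := sum_reflect; rewrite !big_split /=.
rewrite /lt_count /le_count /leS_count /swap.
have [->|/eqP jk] := j =P k; first by rewrite ltn_eqF //; lia.
have [->|/eqP jk'] := j =P k.+1; first lia.
by have := count_mem_flatten t j; lia.
Qed.

End BenderKnuthTheory.

(** * Symmetry of Schur polynomials *)
Lemma bender_knuth_upto la N k : sorted geq la -> 0 < k -> k < N ->
  perm_eq (map (bender_knuth k) (SSYT_upto la N)) (SSYT_upto la N).
Proof.
move=> las k0 kN.
have tabP t : t \in SSYT_upto la N -> sorted geq (shape t) /\ semistandard ltn t.
  by rewrite mem_SSYT_upto => /andP[/and3P[/eqP-> ? _] _].
have stab t : t \in SSYT_upto la N -> bender_knuth k t \in SSYT_upto la N.
  move=> tS; have [sh ss] := tabP _ tS; move: tS.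
  rewrite !mem_SSYT_upto !inE shape_bender_knuth // => /andP[/and3P[-> _ t0] tN].
  rewrite bender_knuth_semistandard //= !(perm_all _ (perm_bender_knuth k sh ss)) !all_map.
  by apply/andP; split; [move: t0|move: tN]; apply: sub_all => x /=;
     rewrite /swap; repeat case: ifP => _; lia.
have bkK t : t \in SSYT_upto la N -> bender_knuth k (bender_knuth k t) = t.
  by case/tabP; exact: bender_knuthK.
apply: uniq_perm; rewrite ?SSYT_upto_uniq //.
  rewrite map_inj_in_uniq ?SSYT_upto_uniq // => t u tS uS e.
  by rewrite -(bkK t) // e bkK.
move=> t; apply/mapP/idP => [[u uS ->]|tS]; first exact: stab.
by exists (bender_knuth k t); rewrite ?stab ?bkK.
Qed.

(** Symmetry of Schur polynomials in a form without polynomials: the letters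
    [1, 2, ...] are replaced by the items of a list, and up to rearrangement the
    family of results does not depend on the order of that list. For [G] a
    product in a commutative ring this is the usual symmetry; taking tableaux or
    words as items gives it for plethysms. *)
Lemma SSYT_relabel_perm (V U : eqType) (x0 : V) (G : seq V -> U) la L1 L2 :
  sorted geq la -> (forall s1 s2, perm_eq s1 s2 -> G s1 = G s2) ->
  perm_eq L1 L2 ->
  perm_eq
    [seq G [seq nth x0 L1 b.-1 | b <- flatten t] | t <- SSYT_upto la (size L1)]
    [seq G [seq nth x0 L2 b.-1 | b <- flatten t] | t <- SSYT_upto la (size L2)].
Proof.
move=> las GP; move: L1 L2; apply: perm_adjacent_ind => [//|? ? ?|s a b s'].
  exact: perm_trans.
set L1 := s ++ _; set L2 := s ++ _; set k := (size s).+1.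
have -> : size L2 = size L1 by rewrite !size_cat /= .
have bk := @bender_knuth_upto la (size L1) k las isT.
rewrite (_ : [seq _ | t <- _] = [seq G [seq nth x0 L2 b.-1 | b <- flatten t]
   | t <- map (bender_knuth k) (SSYT_upto la (size L1))]).
  by rewrite perm_map // bk // size_cat /= /k; lia.
rewrite -map_comp; apply/eq_in_map => t; rewrite mem_SSYT_upto.
case/andP=> /and3P[/eqP sh ss t0] _ /=.
(* The exchange of [k] and [k.+1] in the tableau undoes that of the items at the
   positions [size s] and [(size s).+1] of the list. *)
apply/GP; rewrite perm_sym.
apply: perm_trans (perm_map _ (perm_bender_knuth k _ ss)) _; first by rewrite sh.
rewrite -map_comp; apply: (eq_ind _ (perm_eq _) (perm_refl _)); apply/eq_in_map.
move=> [|c] ct; first by move/allP: t0 => /(_ _ ct).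
rewrite /= /swap /k eqSS; case: eqP => [->|/eqP cs].
  by rewrite /L1 /L2 /= !nth_cat ltnn ltnNge leqnSn subnn subSnn.
rewrite eqSS; case: eqP => [->|/eqP cs'].
  by rewrite /L1 /L2 /= !nth_cat ltnn ltnNge leqnSn subnn subSnn.
rewrite /= /L1 /L2 !nth_cat; case: ltnP => // sc.
by case E : (c - size s) => [|[|i]] //; lia.
Qed.

(** Contents are compared through words. A word has content [al] when it is a
    rearrangement of this one, whatever the number of variables, so the zeros at
    the end of [al] do not matter. *)
Definition content_word (al : seq nat) : seq nat := flatten (superstandard 0 al).

Lemma count_content_word al j :
  count_mem j (content_word al) = if j is j'.+1 then nth 0 al j' else 0.
Proof.
case: j => [|j]; last exact: (superstandard_count 0).
by apply/count_memPn/negP => /superstandard_mem.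
Qed.

Lemma size_content_word al : size (content_word al) = sumn al.
Proof. by rewrite size_flatten shape_superstandard. Qed.

Lemma mem_content_word al x : x \in content_word al -> 0 < x <= size al.
Proof. exact: superstandard_mem. Qed.

Lemma perm_swap_content_word s a b s' :
  perm_eq (map (swap (size s).+1) (content_word (s ++ a :: b :: s'))) (content_word (s ++ b :: a :: s')).
Proof.
set k := (size s).+1.
apply/allP => j _ /=; apply/eqP.
rewrite count_map (@eq_count _ _ (pred1 (swap k j))); last first.
  by move=> x /=; rewrite (can2_eq (@swapK k) (@swapK k)).
rewrite !count_content_word /swap /k; case: j => [|j] //=; rewrite !eqSS.
case: eqP => [->|/eqP js]; first by rewrite !nth_cat ltnn ltnNge leqnSn subnn subSnn.
case: eqP => [->|/eqP js'].
  by rewrite !nth_cat ltnn ltnNge leqnSn subnn subSnn.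
rewrite /= !nth_cat; case: ltnP => // sc.
by case E : (j - size s) => [|[|i]] //; lia.
Qed.

Lemma perm_map_swap k s1 s2 :
  perm_eq (map (swap k) s1) s2 = perm_eq s1 (map (swap k) s2).
Proof. by apply/idP/idP => /(perm_map (swap k)); rewrite mapK //; exact: swapK. Qed.

Definition kostka la N X := count (fun t => perm_eq (flatten t) X) (SSYT_upto la N).

Lemma kostka_swap la N k X : sorted geq la -> 0 < k -> k < N ->
  kostka la N (map (swap k) X) = kostka la N X.
Proof.
move=> las k0 kN; rewrite /kostka -[RHS](permP (bender_knuth_upto las k0 kN)).
rewrite count_map; apply: eq_in_count => t; rewrite mem_SSYT_upto.
case/andP=> /and3P[/eqP sh ss t0] _ /=.
rewrite -perm_map_swap; apply: permPl; rewrite perm_sym.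
by apply: perm_bender_knuth; rewrite ?sh.
Qed.

(** The word of the monomial obtained from the tableau [t] when the [b]th
    variable is replaced by the monomial of the [b]th word of [L]. *)
Definition subst_word (L : seq (seq nat)) (t : seq (seq nat)) : seq nat :=
  flatten [seq nth [::] L b.-1 | b <- flatten t].

Definition subst_count nu L X :=
  count (fun t => perm_eq (subst_word L t) X) (SSYT_upto nu (size L)).

Lemma subst_count_perm nu L1 L2 X : sorted geq nu -> perm_eq L1 L2 ->
  subst_count nu L1 X = subst_count nu L2 X.
Proof.
move=> nus L12.
have GP (s1 s2 : seq (seq nat)) : perm_eq s1 s2 ->
    perm_eq (flatten s1) X = perm_eq (flatten s2) X.
  by move/perm_flatten/permPl.
by have /permP/(_ id) := SSYT_relabel_perm [::] nus GP L12; rewrite !count_map.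
Qed.

Lemma perm_flatten_map (I : eqType) (s : seq I) (f g : I -> seq nat) :
  (forall i, perm_eq (f i) (g i)) -> perm_eq (flatten (map f s)) (flatten (map g s)).
Proof. by move=> fg; elim: s => //= i s IH; apply: perm_cat. Qed.

Lemma subst_count_map nu k L1 L2 X : size L1 = size L2 ->
  (forall i, perm_eq (nth [::] L1 i) (map (swap k) (nth [::] L2 i))) ->
  subst_count nu L1 X = subst_count nu L2 (map (swap k) X).
Proof.
move=> sz H; rewrite /subst_count sz; apply: eq_count => t.
rewrite -perm_map_swap /subst_word [map (swap k) _]map_flatten -map_comp.
apply: permPl; exact: (perm_flatten_map (flatten t) (fun b => H b.-1)).
Qed.

Definition tableau_words mu N := map flatten (SSYT_upto mu N).

(** A plethysm is symmetric: exchanging two variables in the words of the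
    [mu]-tableaux rearranges the list of those words, up to rearrangement of the
    letters in each, and the order of the list does not matter. *)
Lemma subst_count_swap mu nu N k X : sorted geq mu -> sorted geq nu ->
  0 < k -> k < N ->
  subst_count nu (tableau_words mu N) (map (swap k) X) =
  subst_count nu (tableau_words mu N) X.
Proof.
move=> mus nus k0 kN.
have bk := perm_map flatten (bender_knuth_upto mus k0 kN).
rewrite -[RHS](subst_count_perm _ nus bk); apply/esym/subst_count_map.
  by rewrite !size_map.
move=> i; have [iN|Ni] := ltnP i (size (SSYT_upto mu N)); last first.
  by rewrite !nth_default ?size_map.
rewrite -map_comp /tableau_words !(nth_map [::]) //=.
have := mem_nth [::] iN; rewrite mem_SSYT_upto => /andP[/and3P[/eqP sh ss _] _].
by apply: perm_bender_knuth; rewrite ?sh.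
Qed.

(** * The order on tableaux *)
Lemma column_ltP c d : reflect
  (exists x, [/\ x \in d, x \notin c & forall y, (y \in c) != (y \in d) -> y <= x])
  (column_lt c d).
Proof.
apply: (iffP hasP) => [[x xd /andP[xc /allP H]]|[x [xd xc H]]]; exists x => //.
  split=> // y ycd.
  have /H : y \in c ++ d by rewrite mem_cat; move: ycd; do 2!case: (y \in _).
  by move: ycd; do 2!case: (y \in _).
rewrite xc /=; apply/allP => y; rewrite mem_cat; have := H y.
by do 2!case: (y \in _) => //=; apply.
Qed.

Lemma column_lt_irr c : column_lt c c = false.
Proof. by apply/column_ltP => -[x [->]]. Qed.

(** If [x] and [y] witness the two comparisons, the larger of them witnesses
    their composition. They differ, as the middle column contains [x] but not
    [y]. *)
Lemma column_lt_trans : transitive column_lt.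
Proof.
move=> d c e /column_ltP[x [xd xc Hx]] /column_ltP[y [ye yd Hy]].
have xy : x != y by apply: contraNneq yd => <-.
apply/column_ltP; have [lt|ge] := ltnP x y.
  exists y; split=> // [|z zce].
    by apply: contraTN lt => yc; rewrite -leqNgt Hx // yc (negbTE yd).
  have [zcd|zcd] := boolP ((z \in c) != (z \in d)).
    by rewrite ltnW // (leq_ltn_trans (Hx _ zcd)).
  by apply: Hy; move: zce zcd; do 3!case: (z \in _).
have {xy}ge : y < x by rewrite ltn_neqAle eq_sym xy.
exists x; split=> // [|z zce].
  by apply: contraTT ge => xe; rewrite -leqNgt Hy // xd (negbTE xe).
have [zcd|zcd] := boolP ((z \in c) != (z \in d)); first exact: Hx.
apply: leq_trans (ltnW ge); apply: Hy.
by move: zce zcd; do 3!case: (z \in _).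
Qed.

(** The largest entry in exactly one of the columns decides the comparison. Two
    columns with the same entries are equal because they are sorted. *)
Lemma column_lt_total c d : sorted ltn c -> sorted ltn d -> c != d ->
  column_lt c d || column_lt d c.
Proof.
move=> sc sd cd.
have /hasP[x0 x0cd ne0] : has (fun x => (x \in c) != (x \in d)) (c ++ d).
  apply: contraNT cd => /hasPn H; apply/eqP.
  apply: (irr_sorted_eq ltn_trans ltnn) => // x.
  have := H x; rewrite mem_cat.
  by case: (x \in c); case: (x \in d) => //= /(_ isT).
have x0S : x0 \in [seq x <- c ++ d | (x \in c) != (x \in d)].
  by rewrite mem_filter ne0.
have [x] := seq_argmax id x0S; rewrite mem_filter => /andP[ne _] H.
have {}H y : (y \in c) != (y \in d) -> y <= x.
  move=> ycd; apply: H; rewrite mem_filter ycd mem_cat.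
  by move: ycd; do 2!case: (y \in _).
have [xd|xd] := boolP (x \in d).
  apply/orP; left; apply/column_ltP; exists x; split=> //.
  by move: ne; rewrite xd; case: (x \in c).
apply/orP; right; apply/column_ltP; exists x; split=> // [|y].
  by move: ne; rewrite (negbTE xd); case: (x \in c).
by rewrite eq_sym; exact: H.
Qed.

Lemma tableau_ltP t u : reflect
  (exists2 j, j < size (head [::] t) & column_lt (column t j) (column u j) /\
     forall k, j < k < size (head [::] t) -> column t k = column u k)
  (tableau_lt t u).
Proof.
apply: (iffP hasP) => [[j]|[j jw [lt H]]]; rewrite ?mem_iota /=.
  move=> jw /andP[lt /allP H]; exists j => //; split=> // k /andP[jk kw].
  by have := H k; rewrite mem_iota kw jk => /(_ isT)/eqP.
exists j; rewrite ?mem_iota // lt; apply/allP => k; rewrite mem_iota /= => kw.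
by apply/implyP => jk; rewrite H ?jk.
Qed.

Lemma eq_columns (T : eqType) (t u : seq (seq T)) : sorted geq (shape t) ->
  shape t = shape u -> 
  (forall j, j < size (head [::] t) -> column t j = column u j) -> t = u.
Proof.
elim: t u => [|r t IH] [|q u] //= sh [szr szt] H.
have getE (x0 : T) (s : seq T) (v : seq (seq T)) j : j < size s ->
    column (s :: v) j = nth x0 s j :: column v j.
  by move=> js; rewrite /column /= onthE (nth_map x0).
have rq : r = q.
  case: r szr H {sh} => [|x0 r] szr H; first by case: q szr H.
  apply: (@eq_from_nth _ x0) => // j jr; have := H j jr.
  by rewrite !(getE x0) // -?szr // => -[].
congr (_ :: _) => //; apply: IH => //; first exact: path_sorted sh.
move=> j jt; have jr : j < size r.
  move: sh jt; clear; case: t => //= p t /andP[pr _] jt; exact: leq_trans pr.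
have x0 : T by case: (r) jr => // x0.
by have := H j jr; rewrite !(getE x0) // -?szr // => -[].
Qed.

Section TableauOrder.
Variable mu : seq nat.
Hypothesis mus : sorted geq mu.

Lemma SSYT_width t : t \in SSYT mu -> size (head [::] t) = head 0 mu.
Proof. by case/and3P=> /eqP <- _ _; case: t. Qed.

Lemma SSYT_column t j : t \in SSYT mu -> sorted ltn (column t j).
Proof.
move=> tS; case/and3P: (tS) => /eqP sh /andP[_ /allP H] _.
have [jw|wj] := ltnP j (size (head [::] t)).
  by apply: H; rewrite mem_iota.
by rewrite column_oversize // sh.
Qed.

Lemma tableau_lt_irr t : tableau_lt t t = false.
Proof. by apply/tableau_ltP => -[j _]; rewrite column_lt_irr => -[]. Qed.

Lemma tableau_lt_trans : {in SSYT mu & &, transitive tableau_lt}.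
Proof.
move=> u t v uS tS vS /tableau_ltP[i iw [lti Hi]] /tableau_ltP[j jw [ltj Hj]].
move: iw Hi jw Hj; rewrite !SSYT_width // => iw Hi jw Hj.
apply/tableau_ltP; rewrite SSYT_width //; case: (ltngtP i j) => ij.
- exists j => //; split=> [|k /andP[jk kw]]; first by rewrite Hi // ij.
  by rewrite Hi ?Hj ?jk ?(ltn_trans ij).
- exists i => //; split=> [|k /andP[ik kw]]; first by rewrite -Hj // ij.
  by rewrite Hi ?Hj ?ik ?(ltn_trans ij).
exists j => //; split=> [|k kw]; last by rewrite Hi ?Hj // ij.
by apply: column_lt_trans ltj; rewrite -ij.
Qed.

(** Tableaux of the same shape with the same columns are equal; otherwise the
    rightmost column where they differ decides. *)
Lemma tableau_lt_total t u : t \in SSYT mu -> u \in SSYT mu ->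
  [|| t == u, tableau_lt t u | tableau_lt u t].
Proof.
move=> tS uS; set w := head 0 mu.
(* Scanning the columns from the left, remember the last difference. *)
have H n : (forall k, k < n -> column t k = column u k) \/
    exists2 j, j < n & column t j != column u j /\
      forall k, j < k < n -> column t k = column u k.
  elim: n => [|n IH]; first by left.
  have [e|ne] := eqVneq (column t n) (column u n); last first.
    by right; exists n => //; split=> // k; lia.
  case: IH => [IH|[j jn [ne IH]]].
    by left=> k; rewrite ltnS leq_eqVlt => /predU1P[->//|]; exact: IH.
  right; exists j; first exact: ltnW.
  split=> // k; rewrite ltnS [k <= n]leq_eqVlt => /andP[jk /predU1P[->//|kn]].
  by apply: IH; rewrite jk.
case/and3P: (tS) (uS) => /eqP sht _ _ /and3P[/eqP shu _ _].
case: (H w) => [eqc|[j jw [ne eqc]]].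
  rewrite (@eq_columns _ t u) ?eqxx // ?sht ?shu // => j.
  by rewrite SSYT_width //; exact: eqc.
have /orP[lt|lt] := column_lt_total (SSYT_column j tS) (SSYT_column j uS) ne.
  by apply/or3P/Or32/tableau_ltP; rewrite SSYT_width //; exists j.
apply/or3P/Or33/tableau_ltP; rewrite SSYT_width //; exists j => //.
by split=> // k kw; rewrite eqc.
Qed.

End TableauOrder.

(** * Plethystic tableaux as substitutions *)
Lemma column_map (T U : eqType) (f : T -> U) t j :
  column (map (map f) t) j = map f (column t j).
Proof.
elim: t => // r t IH; rewrite /column /= -!/(column _ _) IH.
by rewrite !onthE -map_comp; case: (ltnP j (size r)) => jr;
  [case: r jr => // x0 r jr; rewrite !(nth_map x0) | rewrite !nth_default ?size_map].
Qed.

Lemma mem_column (T : eqType) (t : seq (seq T)) j x :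
  x \in column t j -> x \in flatten t.
Proof.
rewrite mem_pmap => /mapP[r rt /esym xr]; apply/flattenP; exists r => //.
by rewrite -(onth_nth x _ _ _ xr) mem_nth // -onthTE xr.
Qed.

(** Semistandardness only depends on the order of the entries. *)
Lemma semistandard_map (T U : eqType) (lt : rel T) (lt' : rel U) (f : T -> U) t :
  {in flatten t &, forall x y, lt' (f x) (f y) = lt x y} ->
  {in flatten t &, injective f} ->
  semistandard lt' (map (map f) t) = semistandard lt t.
Proof.
move=> ltE finj; congr (_ && _).
  rewrite all_map; apply: eq_in_all => r rt /=.
  have rP x : x \in r -> x \in flatten t by move=> xr; apply/flattenP; exists r.
  apply: (@mono_sorted_in _ _ (mem r)) => [x y /rP xt /rP yt /=|]; last exact/allP.
  by rewrite ltE // (inj_in_eq finj).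
have -> : size (head [::] (map (map f) t)) = size (head [::] t).
  by case: (t) => //= r t'; rewrite size_map.
apply: eq_all => j; rewrite column_map.
apply: (@mono_sorted_in _ _ (mem (column t j))); last exact/allP.
by move=> x y /mem_column xt /mem_column yt /=; rewrite ltE.
Qed.

Lemma count_eq_uniq (T : eqType) (p : pred T) (s1 s2 : seq T) : uniq s1 -> uniq s2 ->
  (forall x, p x -> (x \in s1) = (x \in s2)) -> count p s1 = count p s2.
Proof.
move=> u1 u2 H; rewrite -!size_filter; apply: perm_size.
apply: uniq_perm; rewrite ?filter_uniq // => x; rewrite !mem_filter.
by case: (boolP (p x)) => //= /H.
Qed.

Lemma flatten_flatten (T : Type) (s : seq (seq (seq T))) :
  flatten (flatten s) = flatten (map flatten s).
Proof. by elim: s => //= x s IH; rewrite flatten_cat IH. Qed.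

Lemma all_flatten (T : Type) (a : pred T) ss : all a (flatten ss) = all (all a) ss.
Proof. by elim: ss => //= s ss IH; rewrite all_cat IH. Qed.

Definition plethystic_upto mu nu N :=
  [seq T <- fillings nu (SSYT_upto mu N) | semistandard tableau_lt T].

Definition entries (T : seq (seq (seq (seq nat)))) : seq nat :=
  flatten (flatten (flatten T)).

Lemma mem_plethystic_upto mu nu N T : (T \in plethystic_upto mu nu N) =
  (T \in plethystic_SSYT mu nu) && all (geq N) (entries T).
Proof.
rewrite mem_filter mem_fillings inE andbCA.
case: (shape T == nu); case: (semistandard _ _) => //=.
rewrite /entries (all_flatten _ (flatten _)) (all_flatten _ (flatten T)).
rewrite -[RHS]all_predI; apply: eq_all => t /=.
by rewrite mem_SSYT_upto all_flatten.
Qed.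

Lemma plethystic_upto_uniq mu nu N : uniq (plethystic_upto mu nu N).
Proof. by rewrite filter_uniq // fillings_uniq // SSYT_upto_uniq. Qed.

Section SortedEntries.
Variables (mu nu : seq nat) (N : nat).
Hypotheses (mus : sorted geq mu) (nus : sorted geq nu).

Let S := SSYT_upto mu N.
Let le (t u : seq (seq nat)) := (t == u) || tableau_lt t u.

Definition sorted_SSYT := sort le S.
Let S' := sorted_SSYT.

Let S'S : all (mem (SSYT mu)) S'.
Proof. by apply/allP => t; rewrite mem_sort mem_SSYT_upto => /andP[]. Qed.

Let S'uniq : uniq S'.
Proof. by rewrite sort_uniq SSYT_upto_uniq. Qed.

(** The sort uses the reflexive closure of the order; as the list has no
    repetition the comparison of distinct positions is strict. *)
Lemma sorted_SSYT_ltn i j : i < j -> j < size S' ->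
  tableau_lt (nth [::] S' i) (nth [::] S' j).
Proof.
move=> ij jS; have iS := ltn_trans ij jS.
have letr : {in SSYT mu & &, transitive le}.
  move=> u t v uS tS vS; rewrite /le => /predU1P[->//|tu] /predU1P[<-|uv].
    by rewrite tu orbT.
  by rewrite (tableau_lt_trans uS tS vS) ?orbT.
have leto : {in SSYT mu &, total le}.
  move=> t u tS uS; rewrite /le [u == t]eq_sym.
  by have /or3P[->|->|->] := tableau_lt_total mus tS uS; rewrite ?orbT.
have Sall : all (mem (SSYT mu)) S.
  by apply/allP => t; rewrite mem_SSYT_upto => /andP[].
have S'sorted := sort_sorted_in leto Sall.
have /predU1P[/eqP|//] := sorted_ltn_nth_in letr [::] S'S S'sorted i j iS jS ij.
by rewrite nth_uniq // ltn_eqF.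
Qed.

Let f b := nth [::] S' b.-1.

Let ltE : {in [pred b | 0 < b <= size S'] &,
  forall a b, tableau_lt (f a) (f b) = (a < b)}.
Proof.
move=> [|a] [|b] // /andP[_ aS] /andP[_ bS]; rewrite /f /= ltnS.
have memS i : i < size S' -> nth [::] S' i \in SSYT mu.
  by move=> iS; move/all_nthP: S'S; apply.
case: (ltngtP a b) => ab; first by rewrite sorted_SSYT_ltn.
  apply/negP => lt; have := sorted_SSYT_ltn ab aS => /(tableau_lt_trans _ _ _ lt).
  by rewrite tableau_lt_irr => /(_ mu (memS _ bS) (memS _ aS) (memS _ aS)).
by rewrite ab tableau_lt_irr.
Qed.

Let finj : {in [pred b | 0 < b <= size S'] &, injective f}.
Proof.
move=> [|a] [|b] // /andP[_ aS] /andP[_ bS] /eqP.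
by rewrite /f nth_uniq //= => /eqP->.
Qed.

Let perm_relabel : perm_eq (map (map (map f)) (SSYT_upto nu (size S')))
  (plethystic_upto mu nu N).
Proof.
have dom t : t \in SSYT_upto nu (size S') -> 
    {subset flatten t <= [pred b | 0 < b <= size S']}.
  rewrite mem_SSYT_upto => /andP[/and3P[_ _ /allP t0] /allP tS] b bt.
  by rewrite inE (t0 _ bt); exact: (tS _ bt).
have inj t u : t \in SSYT_upto nu (size S') -> u \in SSYT_upto nu (size S') ->
    map (map f) t = map (map f) u -> t = u.
  move=> tS uS e.
  have /eqP sh : shape t == shape u.
    move: tS uS; rewrite !mem_SSYT_upto => /andP[/and3P[/eqP-> _ _] _].
    by case/andP=> /and3P[/eqP-> _ _] _.
  have ef : map f (flatten t) = map f (flatten u) by rewrite !map_flatten e.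
  rewrite -(flattenK t) -(flattenK u) sh; congr reshape.
  have sz : size (flatten t) = size (flatten u) by rewrite !size_flatten sh.
  apply: (eq_from_nth (x0 := 0) sz) => i it.
  apply: finj; [apply: (dom t)|apply: (dom u)|]; rewrite ?mem_nth -?sz //.
  by rewrite -!(nth_map _ [::]) ?ef -?sz.
apply: uniq_perm; rewrite ?plethystic_upto_uniq //.
  by rewrite map_inj_in_uniq ?SSYT_upto_uniq.
move=> T; apply/mapP/idP => [[t tS ->]|].
  rewrite mem_filter mem_fillings.
  have lt := sub_in2 (dom _ tS) ltE; have ij := sub_in2 (dom _ tS) finj.
  rewrite (semistandard_map (lt := ltn) lt ij).
  move: (tS); rewrite mem_SSYT_upto => /andP[/and3P[/eqP sh -> _] _] /=.
  rewrite -map_flatten all_map -sh; apply/andP; split.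
    by rewrite /shape -map_comp; apply/eqP/eq_map => r /=; rewrite size_map.
  apply/allP => b /(dom _ tS) /=; case: b => // b bS.
  by rewrite -[_ \in _](mem_sort le) mem_nth.
rewrite mem_filter mem_fillings => /and3P[Tss /eqP sh TS].
pose g x := (index x S').+1.
have gS x : x \in flatten T -> x \in S'.
  by move=> xT; rewrite mem_sort; move/allP: TS => /(_ _ xT).
have fgT : map (map f) (map (map g) T) = T.
  rewrite -map_comp -[RHS]map_id; apply/eq_in_map => r rT /=.
  rewrite -map_comp -[RHS]map_id; apply/eq_in_map => x xr /=.
  by rewrite /f /g /= nth_index // gS //; apply/flattenP; exists r.
exists (map (map g) T) => //.
have gdom : {subset flatten (map (map g) T) <= [pred b | 0 < b <= size S']}.
  by move=> b; rewrite -map_flatten => /mapP[x /gS xS ->]; rewrite inE index_mem.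
rewrite mem_SSYT_upto !inE -(semistandard_map (sub_in2 gdom ltE) (sub_in2 gdom finj)).
rewrite fgT Tss -sh /= -andbA; apply/and3P; split.
- by rewrite /shape -map_comp; apply/eqP/eq_map => r /=; rewrite size_map.
- by apply/allP => b /gdom /andP[].
- by apply/allP => b /gdom /andP[].
Qed.

(** The order in which the monomials of the [mu]-tableaux are substituted being
    immaterial, take them in increasing order of their tableaux. Replacing each
    number [b] by the [b]th [mu]-tableau then preserves and reflects the order,
    so it matches semistandard [nu]-tableaux with plethystic tableaux. *)
Lemma subst_count_plethystic X :
  subst_count nu (tableau_words mu N) X =
  count (fun T => perm_eq (entries T) X) (plethystic_upto mu nu N).
Proof.
have perm : perm_eq (tableau_words mu N) (map flatten S').
  by apply: perm_map; rewrite perm_sym; apply/permPl/perm_sort.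
rewrite (subst_count_perm _ nus perm) -(permP perm_relabel) count_map /subst_count.
rewrite size_map; apply: eq_count => t /=; congr (perm_eq _ _).
rewrite /subst_word /entries -map_flatten flatten_flatten -map_comp.
congr flatten; apply: eq_map => b /=; rewrite /f.
have [bS|Sb] := ltnP b.-1 (size S'); first by rewrite (nth_map [::]).
by rewrite !nth_default ?size_map.
Qed.

End SortedEntries.

(** * Weights *)

(** A weight ends at the greatest entry, hence not with [0]. This is the normal
    form that makes a composition recoverable from its values. The default [1]
    makes the empty composition trimmed. *)
Definition trimmed (al : seq nat) : bool := last 1 al != 0.

Lemma trimmed_eq al be : trimmed al -> trimmed be ->
  (forall i, nth 0 al i = nth 0 be i) -> al = be.
Proof.
have sz a b : trimmed a -> (forall i, nth 0 a i = nth 0 b i) -> size a <= size b.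
  case/lastP: a => // a x; rewrite /trimmed last_rcons size_rcons => x0 H.
  rewrite ltnNge; apply: contra x0 => ba.
  by have := H (size a); rewrite nth_rcons ltnn eqxx nth_default // => ->.
move=> ta tb H; apply: (@eq_from_nth _ 0) => // ; apply/eqP.
by rewrite eqn_leq !sz.
Qed.

Lemma partition_trimmed la : is_partition la -> trimmed la.
Proof.
case/andP=> _; rewrite /trimmed; case: la => // a la.
by apply: contra => /eqP <-; exact: mem_last.
Qed.

Lemma perm_content_word_inj al be : trimmed al -> trimmed be ->
  perm_eq (content_word al) (content_word be) -> al = be.
Proof.
move=> ta tb /permP e; apply: trimmed_eq => // i.
by have := e (pred1 i.+1); rewrite !count_content_word.
Qed.

Lemma weight_trimmed T : trimmed (weight T).
Proof.
rewrite /weight -/(entries T); move: (entries T) => e.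
have : 0 < \max_(b <- e) b -> \max_(b <- e) b \in e.
  elim: e => [|b e IH]; rewrite ?big_nil // big_cons inE.
  case: (leqP b (\max_(j <- e) j)) => [_ /IH ->|]; rewrite ?orbT //.
  by rewrite eqxx.
rewrite /trimmed; case: (\max_(b <- e) b) => // M /(_ isT) Me.
by rewrite -[M.+1]addn1 iotaD map_cat last_cat /= add1n -lt0n -has_count has_pred1.
Qed.

Lemma perm_weight mu nu T : T \in plethystic_SSYT mu nu ->
  perm_eq (entries T) (content_word (weight T)).
Proof.
case/and3P=> _ _ /allP TS; set e := entries T.
have e0 : 0 \notin e.
  apply/negP => /flattenP[r /flattenP[t /TS /and3P[_ _ /allP t1] rt] r0].
  by have /t1 : 0 \in flatten t by apply/flattenP; exists r.
apply/allP => -[|j] _ /=; rewrite count_content_word.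
  by rewrite (count_memPn e0).
rewrite /weight -/(entries T) -/e.
have [jM|Mj] := ltnP j (\max_(b <- e) b).
  by rewrite (nth_map 0) ?size_iota // nth_iota.
rewrite nth_default ?size_map ?size_iota //; apply/eqP/count_memPn.
apply/negP => je; have : j.+1 <= \max_(b <- e) b by apply: leq_bigmax_seq.
by rewrite ltnNge Mj.
Qed.

Lemma weightP mu nu T al : T \in plethystic_SSYT mu nu -> trimmed al ->
  (weight T == al) = perm_eq (entries T) (content_word al).
Proof.
move=> TS tal; apply/eqP/idP => [<-|e]; first exact: perm_weight TS.
apply: perm_content_word_inj => //; first exact: weight_trimmed.
by rewrite -(permPl (perm_weight TS)).
Qed.

Definition plethystic_count mu nu N X :=
  count (fun T => perm_eq (entries T) X) (plethystic_upto mu nu N).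

Lemma perm_content_word_le N (s al : seq nat) : perm_eq s (content_word al) -> size al <= N ->
  all (geq N) s.
Proof.
move=> e alN; rewrite (perm_all _ e); apply/allP => b /mem_content_word /andP[_ ba] /=.
exact: leq_trans alN.
Qed.

(** Consistency of the truncations: tableaux of content [al] have no entry above
    [size al], so more variables bring in no new ones. *)
Lemma plethystic_count_stable mu nu N al : size al <= N ->
  plethystic_count mu nu N (content_word al) = plethystic_count mu nu (size al) (content_word al).
Proof.
move=> alN; apply: count_eq_uniq; rewrite ?plethystic_upto_uniq // => T e.
by rewrite !mem_plethystic_upto !(perm_content_word_le e).
Qed.

Lemma kostka_stable la N al : size al <= N ->
  kostka la N (content_word al) = kostka la (size al) (content_word al).
Proof.
move=> alN; apply: count_eq_uniq; rewrite ?SSYT_upto_uniq // => t e.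
by rewrite !mem_SSYT_upto !(perm_content_word_le e).
Qed.

Lemma content_word_rcons0 al : content_word (rcons al 0) = content_word al.
Proof.
suff H k : flatten (superstandard k (rcons al 0)) = flatten (superstandard k al).
  exact: H.
by elim: al k => //= a al IH k; rewrite IH.
Qed.

Import GRing.Theory Num.Theory.

(** * Coefficients of Schur functions and plethysms *)
Definition content_mnm N (w : seq nat) : 'X_{1.. N} :=
  [multinom count_mem (val i).+1 w | i < N].

Definition coef (f : truncations) (al : seq nat) : int :=
  ((f (size al))@_(monomial_of al))%R.

Lemma content_mnm_eq al w : all (fun b => 0 < b <= size al) w ->
  (content_mnm (size al) w == monomial_of al) = perm_eq w (content_word al).
Proof.
move=> /allP wN; apply/eqP/permP => [/mnmP H|e].
  apply/permP/allP => -[|j] _ /=; rewrite count_content_word.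
    by apply/eqP/count_memPn/negP => /wN.
  have [ja|aj] := ltnP j (size al).
    by have := H (Ordinal ja); rewrite !mnmE => ->.
  rewrite nth_default //; apply/eqP/count_memPn/negP => /wN /=.
  by rewrite ltnNge aj.
by apply/mnmP => i; rewrite !mnmE (e (pred1 i.+1)) count_content_word.
Qed.

Lemma sum_bool_count (T : Type) (p : pred T) (s : seq T) :
  (\sum_(t <- s) (p t)%:R)%R = (count p s)%:R%R :> ssrint.int.
Proof.
rewrite -sum1_count [in RHS]big_mkcond natr_sum.
by apply: eq_bigr => t _; case: (p t).
Qed.

Lemma coef_schur la al : coef (schur la) al = (kostka la (size al) (content_word al))%:R%R.
Proof.
rewrite /coef mcoeff_schur /kostka -sum_bool_count; apply: eq_big_seq => t.
rewrite mem_SSYT_upto => /andP[/and3P[_ _ t1] tN].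
rewrite -[(_ == _)]/(content_mnm _ _ == _) content_mnm_eq //.
by apply/allP => b bt; rewrite (allP t1 _ bt); exact: (allP tN _ bt).
Qed.

(** Counting the letters of [s] one by one or grouped by value: it converts the
    exponents of a substituted monomial into the content of a word. *)
Lemma sum_relabel (F : nat -> nat) n s : all (fun b => 0 < b <= n) s ->
  \sum_(b <- s) F b.-1 = \sum_(i < n) F i * count_mem i.+1 s.
Proof.
elim: s => [_|b s IH /= /andP[/andP[b0 bn] sn]].
  by rewrite big_nil big1 // => i _; rewrite muln0.
rewrite big_cons IH // [RHS](eq_bigr (fun i : 'I_n =>
  F i * (b == i.+1) + F i * count_mem i.+1 s)) => [|i _]; last by rewrite mulnDr.
rewrite big_split; congr (_ + _).
case: b b0 bn => // b _ bn; rewrite (bigD1 (Ordinal bn)) //= eqxx muln1 big1 ?addn0 //.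
by move=> i ib; rewrite eqSS eq_sym (negbTE (ib : (i : nat) != b)) muln0.
Qed.

Lemma plethysmE nu mu N : (plethysm (schur nu) mu N =
  \sum_(t <- SSYT_upto nu (size (tableau_words mu N)))
    'X_[content_mnm N (subst_word (tableau_words mu N) t)])%R.
Proof.
rewrite /plethysm /schur; set L := map _ _.
have -> : size (tableau_words mu N) = size L by rewrite !size_map.
rewrite raddf_sum; apply: eq_big_seq => t.
rewrite mem_SSYT_upto => /andP[/and3P[_ _ /allP t0] /allP tN] /=.
pose c i := content_mnm N (nth [::] (tableau_words mu N) i).
rewrite comp_mpolyX (eq_bigr (fun i : 'I_(size L) =>
  ('X_[c i] ^+ count_mem i.+1 (flatten t))%R)) => [|i _].
  rewrite mprodXnE; congr mpolyX; apply/mnmP => j; rewrite mnm_sumE mnmE.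
  under eq_bigr do rewrite mulmnE mnmE.
  rewrite -(@sum_relabel (fun i => count_mem j.+1 (nth [::] (tableau_words mu N) i))).
    by rewrite /subst_word count_flatten sumnE !big_map.
  by apply/allP => b bt; rewrite (t0 _ bt); exact: (tN _ bt).
have iS : i < size (SSYT_upto mu N).
  by apply: leq_trans (ltn_ord i) _; rewrite size_map.
by rewrite mnmE (tnth_nth 0%R) /L /c !(nth_map [::]).
Qed.

Lemma mem_subst_word mu nu N t : t \in SSYT_upto nu (size (tableau_words mu N)) ->
  all (fun b => 0 < b <= N) (subst_word (tableau_words mu N) t).
Proof.
rewrite mem_SSYT_upto => /andP[/and3P[_ _ /allP t0] /allP tN].
apply/allP => b /flattenP[w /mapP[c ct ->]].
have cS : c.-1 < size (tableau_words mu N).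
  by have := t0 _ ct; have := tN _ ct; case: (c).
have /mapP[u uS ->] := mem_nth [::] cS => bu.
move: uS; rewrite mem_SSYT_upto => /andP[/and3P[_ _ /allP u0] /allP uN].
by rewrite (u0 _ bu); exact: (uN _ bu).
Qed.

(** The plethysm is the generating function of plethystic tableaux by weight. *)
Lemma coef_plethysm mu nu al : sorted geq mu -> sorted geq nu ->
  coef (plethysm (schur nu) mu) al = (plethystic_count mu nu (size al) (content_word al))%:R%R.
Proof.
move=> mus nus; rewrite /coef plethysmE raddf_sum /plethystic_count.
rewrite -subst_count_plethystic // /subst_count -sum_bool_count.
apply: eq_big_seq => t /mem_subst_word w /=.
by rewrite mcoeffX content_mnm_eq.
Qed.

(** * Expansion of symmetric functions in Schur functions *)

(** The three conditions say that each truncation is a symmetric polynomial, that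
    setting the last variable to [0] gives the previous truncation, and that [f]
    is homogeneous of degree [d]. *)
Definition symmetric_of_degree (d : nat) (f : truncations) : Prop :=
  [/\ forall s a b s', coef f (s ++ a :: b :: s') = coef f (s ++ b :: a :: s'),
      forall al, coef f (rcons al 0) = coef f al &
      forall al, coef f al != 0%R -> sumn al = d].

Lemma schur_symmetric la : sorted geq la -> symmetric_of_degree (sumn la) (schur la).
Proof.
move=> las; split=> [s a b s'|al|al]; rewrite !coef_schur.
- have sz : size (s ++ b :: a :: s') = size (s ++ a :: b :: s') by rewrite !size_cat.
  rewrite -(@kostka_swap _ _ (size s).+1) //; last by rewrite size_cat /=; lia.
  rewrite sz; congr (_%:R)%R; apply: eq_count => t.
  apply: permPr; exact: perm_swap_content_word.
- by rewrite content_word_rcons0 kostka_stable // size_rcons.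
rewrite pnatr_eq0 -lt0n -has_count => /hasP[t].
rewrite mem_SSYT_upto => /andP[/and3P[/eqP <- _ _] _] /perm_size.
by rewrite size_content_word size_flatten => ->.
Qed.

Lemma plethysm_symmetric mu nu : sorted geq mu -> sorted geq nu ->
  symmetric_of_degree (sumn mu * sumn nu) (plethysm (schur nu) mu).
Proof.
move=> mus nus; split=> [s a b s'|al|al]; rewrite !coef_plethysm //.
- have sz : size (s ++ b :: a :: s') = size (s ++ a :: b :: s') by rewrite !size_cat.
  rewrite /plethystic_count -!subst_count_plethystic //.
  rewrite -(@subst_count_swap _ _ _ (size s).+1) //; last by rewrite size_cat /=; lia.
  rewrite sz; congr (_%:R)%R; apply: eq_count => t.
  apply: permPr; exact: perm_swap_content_word.
- by rewrite content_word_rcons0 plethystic_count_stable // size_rcons.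
rewrite pnatr_eq0 -lt0n -has_count => /hasP[T].
rewrite mem_plethystic_upto => /andP[/and3P[/eqP <- _ TS] _] /perm_size.
rewrite size_content_word /entries => <-; rewrite -size_flatten.
elim: (flatten T) TS => [_|t s IH /= /andP[/and3P[/eqP tmu _ _] sS]].
  by rewrite muln0.
by rewrite flatten_cat size_cat IH // size_flatten tmu mulnS.
Qed.

Lemma schur_sum_symmetric d (s : seq (seq nat)) (v : seq nat -> int) :
  (forall la, la \in s -> partition_of d la) ->
  symmetric_of_degree d (fun N => \sum_(la <- s) v la *: schur la N)%R.
Proof.
move=> sd.
have E al : coef (fun N => \sum_(la <- s) v la *: schur la N)%R al =
    (\sum_(la <- s) v la * coef (schur la) al)%R.
  by rewrite /coef raddf_sum; apply: eq_bigr => la _; rewrite /= mcoeffZ.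
have sym la : la \in s -> symmetric_of_degree d (schur la).
  by move/sd => /andP[/andP[las _] /eqP <-]; exact: schur_symmetric.
split=> [w a b w'|al|al]; rewrite !E.
- by apply: eq_big_seq => la /sym[-> _ _].
- by apply: eq_big_seq => la /sym[_ -> _].
move=> nz; have /hasP[la las] : has (fun la => coef (schur la) al != 0%R) s.
  apply: contraNT nz => /hasPn H; rewrite big_seq big1 // => la /H.
  by rewrite negbK => /eqP->; rewrite mulr0.
by have [_ _] := sym _ las; apply.
Qed.

Definition to_partition (al : seq nat) := sort geq [seq x <- al | 0 < x].

Lemma to_partitionP al : partition_of (sumn al) (to_partition al).
Proof.
have gt : total geq by move=> x y; exact: leq_total.
rewrite /partition_of /is_partition sort_sorted // mem_sort mem_filter ltnn /=.
rewrite (perm_sumn (permEl (perm_sort _ _))).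
by apply/eqP; elim: al => //= -[|x] al /= ->.
Qed.

(** Move the zeros of [al] to the end, where they can be removed. *)
Lemma coef_to_partition d f al : symmetric_of_degree d f ->
  coef f al = coef f (to_partition al).
Proof.
case=> swp stab _.
have perm s1 s2 : perm_eq s1 s2 -> coef f s1 = coef f s2.
  by move: s1 s2; apply: perm_adjacent_ind => // s1 s2 s3 -> ->.
have pad j la : coef f (la ++ nseq j 0) = coef f la.
  elim: j la => [|j IH] la; first by rewrite cats0.
  by rewrite /= -cat1s catA cats1 IH stab.
rewrite -[RHS](pad (count (fun x => ~~ (0 < x)) al)); apply: perm.
rewrite perm_sym; apply: perm_trans _ (permEl (perm_filterC (fun x => 0 < x) al)).
apply: perm_cat; first by rewrite perm_sort.
have -> : [seq x <- al | predC (fun x => 0 < x) x] =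
    nseq (count (fun x => ~~ (0 < x)) al) 0; last by [].
by elim: al => //= -[|x] al /= ->.
Qed.

(** A monomial in [N] variables is [monomial_of] its list of exponents, up to the
    identification of the length of that list with [N]. *)
Lemma truncation_coef_eq f g : (forall al, coef f al = coef g al) ->
  forall N, f N = g N.
Proof.
move=> H N; apply/mpolyP => m.
have sz : size (tval (multinom_val m)) = N by rewrite size_tuple.
have mE : m = [multinom nth 0 (tval (multinom_val m)) i | i < N].
  by apply/mnmP => i; rewrite mnmE -(tnth_nth 0 (multinom_val m)).
move: (tval (multinom_val m)) sz mE => al sz ->; subst N; exact: H.
Qed.

Lemma symmetric_eq d f g : symmetric_of_degree d f -> symmetric_of_degree d g ->
  (forall la, partition_of d la -> coef f la = coef g la) -> forall N, f N = g N.
Proof.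
move=> fs gs H; apply: truncation_coef_eq => al.
have [ad|ad] := eqVneq (sumn al) d.
  rewrite (coef_to_partition _ fs) (coef_to_partition _ gs).
  by apply: H; rewrite -ad to_partitionP.
have [[_ _ fd] [_ _ gd]] := (fs, gs).
have /eqP-> : coef f al == 0%R by apply: contraNT ad => /fd/eqP.
by apply/esym/eqP; apply: contraNT ad => /gd/eqP.
Qed.

Lemma partition_bounds d la : partition_of d la ->
  size la <= d /\ all (fun x => x <= d) la.
Proof.
case/andP=> /andP[_ la0] /eqP <-; split.
  elim: la la0 => //= x la IH; rewrite inE negb_or => /andP[x0 /IH].
  by case: x x0 => // x _; lia.
by elim: la {la0} => //= x la IH; rewrite leq_addr; apply: sub_all IH => y; lia.
Qed.

Definition partitions d : seq (seq nat) :=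
  undup [seq la <- flatten [seq words k (iota 0 d.+1) | k <- iota 0 d.+1] |
         partition_of d la].

Lemma mem_partitions d la : (la \in partitions d) = partition_of d la.
Proof.
rewrite mem_undup mem_filter; case: (boolP (partition_of d la)) => // pla.
rewrite andTb.
have [sz ent] := partition_bounds pla.
apply/flattenP; exists (words (size la) (iota 0 d.+1)).
  by apply/mapP; exists (size la); rewrite // mem_iota ltnS.
rewrite mem_words eqxx; apply: sub_all ent => x xd.
by rewrite -[mem _ x]/(x \in iota 0 d.+1) mem_iota ltnS.
Qed.

(** A linear extension of the dominance order. Partitions of [d] have at most [d]
    parts, so the range covers every partial sum at which two of them can
    differ, as [partition_eq] requires. *)
Definition dom_stat d la := \sum_(i < (d + d).+2) sumn (take i la).

Lemma dominates_stat_eq d ka la : partition_of d ka -> partition_of d la ->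
  dominates ka la -> dom_stat d ka <= dom_stat d la -> ka = la.
Proof.
move=> kad lad [_ dom] le.
have lif : (dom_stat d la <= dom_stat d ka ?= iff [forall i : 'I_(d + d).+2,
    true ==> (sumn (take i la) == sumn (take i ka))])%N.
  by apply: leqif_sum => i _; apply/leqifP; have := dom i; rewrite leq_eqVlt; case: eqP.
have /forallP H : [forall i : 'I_(d + d).+2,
    true ==> (sumn (take i la) == sumn (take i ka))].
  by rewrite -(geq_leqif lif).
case/andP: (kad) (lad) => kap _ /andP[lap _].
apply: partition_eq => // i il.
have iL : i < (d + d).+2.
  have [k1 _] := partition_bounds kad; have [l1 _] := partition_bounds lad.
  by rewrite ltnS (leq_trans il) // ltnS leq_add.
by apply/esym/eqP; have := H (Ordinal iL).
Qed.

Lemma dominates_trans be al ga : dominates be al -> dominates al ga -> dominates be ga.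
Proof.
by case=> e1 H1 [e2 H2]; split=> [|i]; [rewrite e1|exact: leq_trans (H2 i) (H1 i)].
Qed.

(** When partitions are listed by increasing [dom_stat], the matrix of Kostka
    numbers is unitriangular, since a nonzero entry forces dominance. So it is
    invertible over the integers. *)
Lemma kostka_solve d (g : seq nat -> int) : exists v : seq nat -> int,
  forall la, partition_of d la ->
    (\sum_(ka <- partitions d) v ka * coef (schur ka) la)%R = g la.
Proof.
pose le a b := dom_stat d a <= dom_stat d b.
pose P := sort le (partitions d); pose n := size P.
have uP : uniq P by rewrite sort_uniq undup_uniq.
have memP la : (la \in P) = partition_of d la by rewrite mem_sort mem_partitions.
have nthP (i : 'I_n) : partition_of d (nth [::] P i) by rewrite -memP mem_nth.
have sP : sorted le P by apply: sort_sorted => a b; exact: leq_total.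
have letr : transitive le by move=> a b c; exact: leq_trans.
pose K := (\matrix_(i < n, j < n) coef (schur (nth [::] P i)) (nth [::] P j))%R.
have Kdiag i : K i i = 1%R.
  by rewrite mxE; apply: schur_diag; case/andP: (nthP i).
have Ktrig : is_trig_mx K.
  apply/is_trig_mxP => i j ij; rewrite mxE; apply/eqP; apply: contraTT ij => nz.
  have pi : is_partition (nth [::] P i) by case/andP: (nthP i).
  have dom := schur_dominates pi nz.
  rewrite -leqNgt leqNgt; apply/negP => ij.
  have lt := sorted_ltn_nth letr [::] sP _ _ (ltn_ord i) (ltn_ord j) ij.
  have /eqP := dominates_stat_eq (nthP i) (nthP j) dom lt.
  by rewrite nth_uniq // ltn_eqF.
have Kunit : K \in unitmx.
  by rewrite unitmxE det_trig // big1 ?unitr1.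
pose c := ((\row_j g (nth [::] P j)) *m invmx K)%R.
pose v ka := if insub (index ka P) is Some i then c 0%R i else 0%R.
exists v => la; rewrite -memP => laP.
have jn : index la P < n by rewrite index_mem.
have vE (i : 'I_n) : v (nth [::] P i) = c 0%R i.
  by rewrite /v index_uniq // valK.
have := congr1 (fun M : 'rV__ => M 0%R (Ordinal jn))
  (mulmxKV Kunit (\row_j g (nth [::] P j))%R).
rewrite -/c [in RHS]mxE /= nth_index // => <-; rewrite mxE.
rewrite -(perm_big _ (permEl (perm_sort le _))) /= -/P (big_nth [::]) big_mkord.
by apply: eq_bigr => i _; rewrite vE [K _ _]mxE /= nth_index.
Qed.

(** Solve for the coefficients at partitions; symmetry and homogeneity extend the
    equality to all monomials, in any number of variables. *)
Lemma schur_expansion_exists d f : symmetric_of_degree d f ->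
  exists2 c, schur_expansion f c & forall la, la \in finsupp c -> partition_of d la.
Proof.
move=> fs; have [v vE] := kostka_solve d (coef f).
pose c : {fsfun seq nat -> int with 0%R} :=
  [fsfun ka in [fset x in partitions d]%fset => v ka | 0%R].
have cE ka : c ka = if partition_of d ka then v ka else 0%R.
  by rewrite fsfunE !inE mem_partitions.
have cS la : (la \in finsupp c) = partition_of d la && (v la != 0%R).
  by rewrite mem_finsupp cE; case: ifP; rewrite ?eqxx.
exists c => [|la]; last by rewrite cS => /andP[].
split=> [la|N]; first by rewrite cS => /andP[/andP[]].
have -> : (\sum_(la <- finsupp c) c la *: schur la N =
           \sum_(ka <- partitions d) v ka *: schur ka N)%R.
  rewrite (perm_big [seq ka <- partitions d | v ka != 0%R]); last first.
    apply: uniq_perm; rewrite ?fset_uniq ?filter_uniq ?undup_uniq // => ka.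
    by rewrite mem_filter mem_partitions cS andbC.
  rewrite big_filter big_mkcond; apply: eq_big_seq => ka.
  rewrite mem_partitions cE => ->.
  by case: eqVneq => //= ->; rewrite scale0r.
apply: (symmetric_eq fs (schur_sum_symmetric v _)) => [la|la lad].
  by rewrite mem_partitions.
rewrite -vE // /coef raddf_sum; apply: eq_bigr => ka _.
by rewrite /= mcoeffZ.
Qed.

(** * Maximal constituents and maximal weights *)
Lemma schur_expansion_coef f c al : schur_expansion f c ->
  (coef f al = \sum_(la <- finsupp c) c la * coef (schur la) al)%R.
Proof.
by case=> _ fE; rewrite /coef fE raddf_sum; apply: eq_bigr => la _; rewrite /= mcoeffZ.
Qed.

Lemma schur_coefE f c : schur_expansion f c -> schur_coef f = c.
Proof.
move=> fc; apply: (schur_expansion_inj _ fc).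
by apply: (xgetPex _ (P := [set c | schur_expansion f c]%classic)); exists c.
Qed.

Lemma hall_expansion f c la : schur_expansion f c -> is_partition la ->
  hall f (schur la) = c la.
Proof.
move=> fc lap; rewrite /hall (schur_coefE fc).
pose e : {fsfun seq nat -> int with 0%R} := [fsfun [fsfun] with la |-> 1%R].
have schurE : schur_expansion (schur la) e.
  have fe : finsupp e = [fset la]%fset by rewrite finsupp_with oner_eq0 finsupp0 fsetU0.
  split=> [x|N]; rewrite fe; first by rewrite inE => /eqP->.
  by rewrite big_seq_fset1 fsfun_with scale1r.
rewrite (schur_coefE schurE).
have E ka : (c ka * e ka = if ka == la then c ka else 0)%R.
  by rewrite fsfun_withE fsfun0E; case: eqP; rewrite ?mulr1 ?mulr0.
under eq_bigr do rewrite E.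
have [lac|lac] := boolP (la \in finsupp c).
  rewrite (bigD1_seq la) ?fset_uniq //= eqxx big1 ?addr0 // => ka /negbTE->.
  by [].
rewrite fsfun_dflt // big_seq big1 // => ka; case: eqP => // ->.
by rewrite (negbTE lac).
Qed.

Lemma coef_neq0_dominates f c al : schur_expansion f c -> coef f al <> 0%R ->
  exists2 ka, ka \in finsupp c & dominates ka al.
Proof.
move=> fc /eqP; rewrite (schur_expansion_coef _ fc) => nz.
have /hasP[ka kac kanz] : has (fun ka => coef (schur ka) al != 0%R) (finsupp c).
  apply: contraNT nz => /hasPn H; rewrite big_seq big1 // => ka /H.
  by rewrite negbK => /eqP->; rewrite mulr0.
by exists ka => //; apply: schur_dominates kanz; case: fc => cp _; exact: cp.
Qed.

Definition support_maximal (c : {fsfun seq nat -> int with 0%R}) (la : seq nat) :=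
  dom_maximal (fun ka => ka \in finsupp c) la.

(** In the expansion of the coefficient at [la], a term [ka] contributes only if
    [ka] dominates [la]; by maximality [la] alone is left, with Kostka number
    [1]. *)
Lemma maximal_coef f c la : schur_expansion f c -> support_maximal c la ->
  coef f la = c la.
Proof.
move=> fc [lac lamax]; have [cp _] := fc.
rewrite (schur_expansion_coef _ fc) (bigD1_seq la) ?fset_uniq //=.
rewrite [coef _ _]schur_diag ?cp // mulr1 big_seq_cond big1 ?addr0 // => ka.
case/andP=> kac kala; apply/eqP; rewrite mulf_eq0; apply/orP; right.
apply: contraNT kala => nz; apply/eqP/lamax => //.
exact: schur_dominates (cp _ kac) nz.
Qed.

(** Among the finitely many elements of the support above [ka], one with the
    greatest [dom_stat] is maximal. *)
Lemma maximal_above d (c : {fsfun seq nat -> int with 0%R}) ka :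
  (forall la, la \in finsupp c -> partition_of d la) -> ka \in finsupp c ->
  exists2 la, support_maximal c la & dominates la ka.
Proof.
move=> cd kac.
have kaS : ka \in [seq la <- finsupp c | `[< dominates la ka >]].
  by rewrite mem_filter kac andbT; apply/asboolP.
have [la] := seq_argmax (dom_stat d) kaS.
rewrite mem_filter => /andP[/asboolP laka lac] H; exists la => //.
split=> // be bec bela; apply: (dominates_stat_eq (cd _ bec) (cd _ lac) bela).
by apply: H; rewrite mem_filter bec andbT; apply/asboolP; apply: dominates_trans laka.
Qed.

(** Dominance both ways makes all partial sums, hence all values, equal; only the
    number of trailing zeros could differ. *)
Lemma dominates_anti al be : trimmed al -> trimmed be ->
  dominates al be -> dominates be al -> al = be.
Proof.
move=> ta tb [_ H1] [_ H2]; apply: trimmed_eq => // i.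
have S (s : seq nat) j : sumn (take j.+1 s) = sumn (take j s) + nth 0 s j.
  have [js|sj] := ltnP j (size s); first by rewrite (take_nth 0) // sumn_rcons.
  by rewrite !take_oversize ?nth_default ?addn0 // ltnW.
have E j : sumn (take j al) = sumn (take j be) by apply/eqP; rewrite eqn_leq H1 H2.
by apply: (@addnI (sumn (take i al))); rewrite -S E S E.
Qed.

Lemma plethystic_count_card mu nu la : trimmed la ->
  ([set T | T \in plethystic_SSYT mu nu /\ weight T = la] #=
     `I_(plethystic_count mu nu (size la) (content_word la)))%classic%card.
Proof.
move=> tla; rewrite /plethystic_count -size_filter.
set s := filter _ _.
have su : uniq s by rewrite filter_uniq // plethystic_upto_uniq.
have -> : [set T | T \in plethystic_SSYT mu nu /\ weight T = la]%classic =
    [set` [fset T in s]%fset]%classic.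
  apply/seteqP; split=> T /=; rewrite in_fset mem_filter mem_plethystic_upto.
    case=> TS wT; have e := weightP TS tla; rewrite wT eqxx in e.
    by rewrite -e TS /=; apply: perm_content_word_le (leqnn _); rewrite -e.
  by case/and3P=> e TS _; split=> //; apply/eqP; rewrite (weightP TS).
by apply/card_eq_fsetP; rewrite card_fseq undup_id.
Qed.

Lemma is_weightP mu nu al : sorted geq mu -> sorted geq nu ->
  is_weight mu nu al <-> trimmed al /\ coef (plethysm (schur nu) mu) al <> 0%R.
Proof.
move=> mus nus; rewrite coef_plethysm //; split.
  case=> T TS wT; have tal : trimmed al by rewrite -wT weight_trimmed.
  split=> //; apply/eqP; rewrite pnatr_eq0 -lt0n -has_count; apply/hasP; exists T.
    rewrite mem_plethystic_upto TS; apply: perm_content_word_le (leqnn _).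
    by rewrite -wT (perm_weight TS).
  by rewrite -(weightP TS) ?wT.
case=> tal /eqP; rewrite pnatr_eq0 -lt0n -has_count => /hasP[T].
rewrite mem_plethystic_upto => /andP[TS _]; rewrite -(weightP TS) // => /eqP wT.
by exists T.
Qed.

Local Open Scope card_scope.
Theorem theorem1p5 (m n : nat) (mu nu : seq nat)
    (hmu : partition_of m mu) (hnu : partition_of n nu) :
  (forall la : seq nat,
     dom_maximal (is_constituent mu nu) la <-> dom_maximal (is_weight mu nu) la) /\
  (forall la : seq nat, dom_maximal (is_constituent mu nu) la ->
     exists2 k : nat,
       [set T | T \in plethystic_SSYT mu nu /\ weight T = la]%classic #= `I_k
       & hall (plethysm (schur nu) mu) (schur la) = k%:Z%R).
Proof.
have mus : sorted geq mu by case/andP: hmu => /andP[].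
have nus : sorted geq nu by case/andP: hnu => /andP[].
have [c fc cd] := schur_expansion_exists (plethysm_symmetric mus nus).
have [cp _] := fc.
have hallE la : is_partition la -> hall (plethysm (schur nu) mu) (schur la) = c la.
  exact: hall_expansion.
have max_weight la : support_maximal c la -> is_weight mu nu la.
  move=> lamax; have [lac _] := lamax; apply/is_weightP => //.
  rewrite (maximal_coef fc lamax) partition_trimmed ?cp //; split=> //.
  by apply/eqP; rewrite -mem_finsupp.
have max_const la : support_maximal c la -> is_constituent mu nu la.
  move=> lamax; have [lac _] := lamax; have lap := cp _ lac; split=> //.
  rewrite hallE // -(maximal_coef fc lamax).
  have /is_weightP[//|//|_] := max_weight _ lamax.
  by rewrite coef_plethysm // => /eqP; rewrite pnatr_eq0 -lt0n ler1n.
have const_supp la : is_constituent mu nu la -> la \in finsupp c.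
  by case=> lap; rewrite hallE // mem_finsupp; apply: contraTneq => ->.
have weight_below al : is_weight mu nu al ->
    exists2 la, support_maximal c la & dominates la al.
  case/is_weightP=> // _ /(coef_neq0_dominates fc)[ka kac kaal].
  have [la lamax laka] := maximal_above cd kac.
  by exists la => //; exact: dominates_trans kaal.
have const_max la : dom_maximal (is_constituent mu nu) la -> support_maximal c la.
  case=> /const_supp lac lamax; have [ka kamax kala] := maximal_above cd lac.
  by rewrite -(lamax ka) //; exact: max_const.
split=> [la|la /const_max lamax]; last first.
  have [lac _] := lamax; have lap := cp _ lac.
  exists (plethystic_count mu nu (size la) (content_word la)).
    exact/plethystic_count_card/partition_trimmed.
  by rewrite hallE // -(maximal_coef fc lamax) coef_plethysm // natz.
split=> [/const_max lamax|[law lamax]].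
  split; first exact: max_weight.
  move=> al alw alla; have [ka kamax kaal] := weight_below _ alw.
  have [kac _] := kamax; have [lac lam] := lamax.
  have kala : ka = la by apply: lam => //; exact: dominates_trans kaal alla.
  apply: dominates_anti => //; last by rewrite -kala.
    by have /is_weightP[] := alw.
  by rewrite partition_trimmed ?cp.
have [ka kamax kala] := weight_below _ law.
have {kala} kala : ka = la by apply: lamax => //; exact: max_weight.
rewrite kala in kamax; split; first exact: max_const.
by move=> be /const_supp bec bela; have [_] := kamax; apply.
Qed.
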